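(* Let $E\in\overline{\mathscr K}$ be a nearly closed subset of $\overline{\mathbb R}$ and let $X$ be a skip-free Hunt process (SFH) on $E$. There exists a continuous and strictly increasing real valued function $\mathbf s$ on $E$ such that for any $a,x,b\in E$ with $a<x<b$, $$\mathbf P_x(T_b<T_a)=\frac{\mathbf s(x)-\mathbf s(a)}{\mathbf s(b)-\mathbf s(a)}.$$ If $\tilde{\mathbf s}$ is another function with the same properties, then $\tilde{\mathbf s}=\alpha\mathbf s+\beta$ with $\alpha>0$ and $\beta\in\mathbb R$.
   Context: **Nearly closed sets.** Let $\overline{\mathbb R}=[-\infty,\infty]$. For $E\subset\overline{\mathbb R}$ put $l=\inf E$, $r=\sup E$. $E$ is a nearly closed subset of $\overline{\mathbb R}$ ($E\in\overline{\mathscr K}$) if $\overline E:=E\cup\{l,r\}$ is closed in $\overline{\mathbb R}$. Cemetery: $E_\partial=E\cup\{\partial\}$, where $\partial$ is an additional isolated point if $E=\overline E$; $\partial$ is identified with $l$ (resp. $r$) if $E=\overline E\setminus\{l\}$ (resp. $E=\overline E\setminus\{r\}$); $E_\partial$ is the one-point compactification of $E$ if $E=\overline E\setminus\{l,r\}$. **SFH.** A Hunt process $X=(\Omega,\mathscr F_t,\theta_t,X_t,\mathbf P_x,\zeta)$ on $E_\partial$ (with $\{\mathscr F_t\}$ the minimum augmented admissible filtration and lifetime $\zeta=\inf\{t>0:X_t=\partial\}$) is a skip-free Hunt process on $E$ if: (SF) for all $x\in E$, $\mathbf P_x$-a.s., $(X_{t-}\wedge X_t,\,X_{t-}\vee X_t)\cap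 E=\emptyset$ for all $t<\zeta$; (SR) $\mathbf P_x(T_y<\infty)>0$ for all $x,y\in E$, where $T_y:=\inf\{t>0:X_t=y\}$, $\inf\emptyset:=\infty$; (SK) if $\mathbf P_x(\zeta<\infty)>0$ for some $x\in E$, then $l\notin E$ or $r\notin E$, and $\mathbf P_x(X_{\zeta-}\notin E,\zeta<\infty)=\mathbf P_x(\zeta<\infty)$. *)

(* Defs.v *)
From HB Require Import structures.
From mathcomp Require Import all_boot all_order all_algebra.
From mathcomp Require Import all_classical all_reals all_analysis.

Set Implicit Arguments.
Unset Strict Implicit.
Unset Printing Implicit Defensive.

Import Order.TTheory GRing.Theory Num.Theory.
Import numFieldNormedType.Exports.

Local Open Scope classical_set_scope.
Local Open Scope ring_scope.
Local Open Scope ereal_scope.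

Definition nearly_closed (R : realType) (E : set (\bar R)) : Prop :=
  closed (E `|` [set ereal_inf E; ereal_sup E]).

(* The carrier of E_∂ is [option E] with ∂ = [None].  "∂ is identified with l"
   means that the neighbourhoods of ∂ are the traces on E of those of l. *)
Definition cemetery (R : realType) (E : set (\bar R)) : Type := option E.

Section cemetery_topology.
Context {R : realType} {E : set (\bar R)}.
Local Notation Ed := (cemetery E).

HB.instance Definition _ := Choice.on Ed.
HB.instance Definition _ := Pointed.on Ed.

Definition identified_nbhs (e : \bar R) : set_system Ed :=
  [set A | A None /\
           \forall y \near e, forall x : E, set_val x = y -> A (Some x)].

Definition cemetery_nbhs (p : Ed) : set_system Ed :=
  match p with
  | Some x => Some @ nbhs x
  | None =>
    match pselect (E (ereal_inf E)), pselect (E (ereal_sup E)) with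
    | left _, left _ => [set A | A None]
    | right _, left _ => identified_nbhs (ereal_inf E)
    | left _, right _ => identified_nbhs (ereal_sup E)
    | right _, right _ => nbhs (None : one_point_compactification E)
    end
  end.

Let identified_filter e : ProperFilter (identified_nbhs e).
Proof.
apply: Build_ProperFilter_ex.
- by move=> A [A0 _]; exists None.
- split.
  + by split=> //; apply: nearW.
  + move=> A B [A0 An] [B0 Bn]; split; first by split.
    near=> y => x xy; split; [exact: (near An y)|exact: (near Bn y)].
  + move=> A B AB [A0 An]; split; first exact: AB.
    by apply: filterS An => y Ay x /Ay /AB.
Unshelve. all: by end_near. Qed.

Let identified_nbhs_nbhs e (A : set Ed) :
  identified_nbhs e A ->
  identified_nbhs e [set p | (if p is Some x then (Some @ nbhs x) A
                              else identified_nbhs e A)].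
Proof.
move=> [A0 An]; split; first by split.
move: (An); rewrite /prop_near1 nbhsE => -[U [oU Ue] UA].
exists U => // y Uy x xy.
have : nbhs x (set_val @^-1` U).
  apply: (@initial_continuous E (\bar R) set_val).
  by apply: open_nbhs_nbhs; split => //; rewrite xy.
by apply: filterS => z Uz; exact: (UA _ Uz z erefl).
Qed.

Let cemetery_filter p : ProperFilter (cemetery_nbhs p).
Proof.
case: p => [x|] /=; first exact: fmap_proper_filter.
case: pselect => ?; case: pselect => ?; last exact: (@nbhs_pfilter (one_point_compactification E)).
2,3: exact: identified_filter.
apply: Build_ProperFilter_ex; first by move=> A ?; exists None.
by split=> // A B AB; exact: AB.
Qed.

Let cemetery_singleton p A : cemetery_nbhs p A -> A p.
Proof.
case: p => [x /= /nbhs_singleton//|] /=.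
case: pselect => ?; case: pselect => ? //.
1,2: by case.
exact: (@nbhs_singleton (one_point_compactification E)).
Qed.

Let cemetery_nbhs_nbhs p A :
  cemetery_nbhs p A -> cemetery_nbhs p (cemetery_nbhs^~ A).
Proof.
case: p => [x|].
  rewrite /= nbhs_simpl nbhsE => -[U [oU Ur] USA/=].
  by exists U => //= z /=; rewrite nbhs_simpl nbhsE => Uz; exists U.
rewrite /cemetery_nbhs.
case: pselect => ?; case: pselect => ? //.
- move=> /identified_nbhs_nbhs.
  by apply: (@filterS _ _ (identified_filter _)) => -[].
- move=> /identified_nbhs_nbhs.
  by apply: (@filterS _ _ (identified_filter _)) => -[].
- move=> /(@nbhs_interior (one_point_compactification E)).
  by apply: (@filterS _ _ (@nbhs_filter (one_point_compactification E) _)) => -[].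
Qed.

HB.instance Definition _ := hasNbhs.Build Ed cemetery_nbhs.
HB.instance Definition _ := @Nbhs_isNbhsTopological.Build Ed
  cemetery_filter cemetery_singleton cemetery_nbhs_nbhs.

End cemetery_topology.

Section mixture.
Context d d' (S : measurableType d) (T : measurableType d') (R : realType).
Variables (k : R.-pker S ~> T) (mu : probability S R).

Definition mixture (A : set T) : \bar R := \int[mu]_x k x A.

Let mixture0 : mixture set0 = 0.
Proof. by apply: integral0_eq => x _; rewrite measure0. Qed.

Let mixture_ge0 A : 0 <= mixture A.
Proof. by apply: integral_ge0 => x _. Qed.

Let mixture_sigma_additive : semi_sigma_additive mixture.
Proof.
move=> F mF tF mUF; rewrite /mixture.
under [X in _ --> X]eq_integral => x _.
  rewrite measure_semi_bigcup//; over.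
rewrite /= integral_nneseries//; last by move=> n; exact: measurable_kernel.
by apply: is_cvg_nneseries => n _ _; exact: integral_ge0.
Qed.

HB.instance Definition _ := isMeasure.Build d' T R mixture
  mixture0 mixture_ge0 mixture_sigma_additive.

Let mixture_setT : mixture setT = 1.
Proof.
rewrite /mixture; under eq_integral do rewrite prob_kernel.
rewrite integral_cst// mul1e; exact: probability_setT.
Qed.

HB.instance Definition _ := Measure_isProbability.Build d' T R mixture
  mixture_setT.

End mixture.

Definition borel_cemetery (R : realType) (E : set (\bar R)) : Type :=
  g_sigma_algebraType (@open (cemetery E)).
HB.instance Definition _ (R : realType) (E : set (\bar R)) :=
  Measurable.on (borel_cemetery E).

(* Time ranges over [0, +oo], as a part of [\bar R]; the values of a process at
   negative times are never used. *)
Definition cylinders (R : realType) (E : set (\bar R)) (Omega : Type)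
    (X : \bar R -> Omega -> cemetery E) (t : \bar R) : set_system Omega :=
  [set X s @^-1` B | s in [set s | 0 <= s <= t] & B in <<s @open (cemetery E) >>].

Definition path_space (R : realType) (E : set (\bar R)) (Omega : pointedType)
    (X : \bar R -> Omega -> cemetery E) : Type :=
  g_sigma_algebraType (cylinders X +oo).
HB.instance Definition _ (R : realType) (E : set (\bar R))
    (Omega : pointedType) (X : \bar R -> Omega -> cemetery E) :=
  Measurable.on (path_space X).

Section process.
Context {R : realType} {E : set (\bar R)} {Omega : pointedType}.
Local Notation Ed := (cemetery E).
Local Notation "∂" := (None : Ed).
Variables (X : \bar R -> Omega -> Ed) (theta : \bar R -> Omega -> Omega).
Variable P : R.-pker (borel_cemetery E) ~> (path_space X).

(* The minimum augmented admissible filtration: for each initial law mu, add to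
   sigma(X_s, s <= t) the P_mu-negligible sets, then intersect over mu. At
   t = +oo this is the intersection of the P_mu-completions. *)
Definition filtration (t : \bar R) : set_system Omega :=
  [set A | forall mu : probability (borel_cemetery E) R,
    <<s cylinders X t `|` (mixture P mu).-negligible >> A].

Definition stopping_time (T : Omega -> \bar R) : Prop :=
  (forall w, 0 <= T w) /\
  (forall t, 0 <= t -> filtration t [set w | T w <= t]).

Definition stopped_filtration (T : Omega -> \bar R) : set_system Omega :=
  [set A | forall t, 0 <= t -> filtration t (A `&` [set w | T w <= t])].

Definition hitting (y : Ed) (w : Omega) : \bar R :=
  ereal_inf [set t | 0 < t /\ X t w = y].

Definition lifetime : Omega -> \bar R := hitting ∂.

Definition left_limit (t : R) (w : Omega) (p : Ed) : Prop :=
  X s%:E w @[s --> t^'-] --> p.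

(* Hitting events are measurable only after completion, so P_mu and P_x are
   taken on the completed sigma-algebras. *)
Local Notation Pmu mu :=
  (@completed_measure_extension _ _ _ (mixture P mu)).
Local Notation Px x :=
  (@completed_measure_extension _ _ _ (P (Some x : Ed))).

Record hunt_process : Prop := {
  hunt_infty : forall w, X +oo w = ∂ ;
  hunt_absorbing : forall w t, 0 <= t -> lifetime w <= t -> X t w = ∂ ;
  hunt_shift : forall s t w, 0 <= s -> 0 <= t ->
    X s (theta t w) = X (s + t) w ;
  hunt_right_continuous : forall w (t : R), 0 <= t%:E ->
    X s%:E w @[s --> t^'+] --> X t%:E w ;
  hunt_left_limit : forall w (t : R), 0 < t%:E -> exists p, left_limit t w p ;
  hunt_normal : forall x : Ed, P x [set w | X 0 w = x] = 1 ;
  hunt_cemetery : forall t, 0 <= t -> P ∂ [set w | X t w = ∂] = 1 ;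
  (* P_mu(X_{T+s} \in B | F_T) = P_{X_T}(X_s \in B), integrated over A in F_T *)
  hunt_strong_markov : forall (mu : probability (borel_cemetery E) R) T (s : R)
      (B : set (borel_cemetery E)) (A : set Omega),
    stopping_time T -> 0 <= s%:E -> measurable B -> stopped_filtration T A ->
    Pmu mu (A `&` [set w | B (X (T w + s%:E) w)]) =
    \int[Pmu mu]_(w in A) P (X (T w) w) (X s%:E @^-1` B) ;
  hunt_quasi_left_continuous : forall (mu : probability (borel_cemetery E) R)
      (T_ : nat -> Omega -> \bar R) (T : Omega -> \bar R),
    (forall n, stopping_time (T_ n)) -> stopping_time T ->
    (forall w, nondecreasing_seq (T_ ^~ w)) ->
    (forall w, T_ n w @[n --> \oo] --> T w) ->
    {ae mixture P mu, forall w, T w < +oo ->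
      X (T_ n w) w @[n --> \oo] --> X (T w) w}
}.

Definition skip_free : Prop := forall x : E,
  {ae P (Some x), forall w, forall t : R, 0 < t%:E < lifetime w ->
    forall u v : E, left_limit t w (Some u) -> X t%:E w = Some v ->
    [set z | mine (set_val u) (set_val v) < z < maxe (set_val u) (set_val v)]
      `&` E = set0}.

Definition skip_free_regular : Prop := forall x y : E,
  0 < Px x [set w | hitting (Some y) w < +oo].

(* X_{ζ-} \notin E means X_{ζ-} = ∂. *)
Definition skip_free_killing : Prop := forall x : E,
  0 < Px x [set w | lifetime w < +oo] ->
  (~ E (ereal_inf E) \/ ~ E (ereal_sup E)) /\
  Px x [set w | exists t : R,
          [/\ 0 < t%:E, lifetime w = t%:E & left_limit t w ∂]] =
  Px x [set w | lifetime w < +oo].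

Definition skip_free_hunt : Prop :=
  [/\ hunt_process, skip_free, skip_free_regular & skip_free_killing].

Definition scale_function (s : E -> R) : Prop :=
  [/\ continuous s,
      (forall x y : E, set_val x < set_val y -> (s x < s y)%R) &
      forall a x b : E, set_val a < set_val x < set_val b ->
        Px x [set w | hitting (Some b) w < hitting (Some a) w] =
        ((s x - s a) / (s b - s a))%:E].

End process.

(* Main.v *)
Require Import Defs.
From mathcomp Require Import all_boot all_order all_algebra.
From mathcomp Require Import all_classical all_reals all_analysis.
From mathcomp Require Import measurable_realfun ring lra.

(**
  Replace the hitting time [T_y] by the entrance time [D_y], the first time at
  which the running supremum (or infimum, according to the position of the
  starting point) reaches y; it sees left limits as well as values, so that its
  level sets are determined by rational times and it is a stopping time although
  the filtration is not assumed right-continuous.  Almost surely [D_y] is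
  the hitting time of y: if the path jumps at [D_y] it does so over no point
  of E, and if the left limit is y (or the cemetery) then quasi-left-continuity,
  applied to the entrance times of levels increasing to y, identifies the value
  with the left limit.

  Write [p(a,x,y)] for the probability to reach y before a from x.
  - From a the path has to visit x before y, hence [P_x(D_y <= t)] is at least
    [P_a(D_y <= t)] for all x in ]a,y[, and the latter is positive for t large;
    by the Markov property the process leaves ]a,y[ in finite time, and the
    killing condition forbids to die inside.
  - [0 < p(a,x,y) < 1]: otherwise going from x to y requires going to a first,
    which forces [P_x(D_y <= t) = 0] for all t.
  - The strong Markov property gives [p(a,x,z) = p(a,x,y) p(a,y,z)] for
    a < x < y < z and the mirror identity for [1 - p].
  These facts alone produce the scale function, normalised at two points c < d,
  and its uniqueness.  Continuity is continuity of the probability along the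
  entrance times of levels increasing to a point.
*)

Set Implicit Arguments.
Unset Strict Implicit.
Unset Printing Implicit Defensive.

Import Order.TTheory GRing.Theory Num.Theory.
Import numFieldNormedType.Exports.

Local Open Scope classical_set_scope.
Local Open Scope ring_scope.
Local Open Scope ereal_scope.

(** * Extended reals and the topology of the cemetery space *)

Section ereal_approximation.
Context {R : realType}.
Implicit Types (x y c : \bar R).

Lemma ereal_rat_in_itvoo x y :
  x < y -> exists2 q : rat, x < (ratr q)%:E & (ratr q)%:E < y.
Proof.
case: x => [x| |]; case: y => [y| |] //.
- rewrite lte_fin => /rat_in_itvoo[q]; rewrite in_itv/= => /andP[xq qy].
  by exists q; rewrite lte_fin.
- move=> _; have /rat_in_itvoo[q] : (x < x + 1)%R by rewrite ltrDl.
  by rewrite in_itv/= => /andP[xq _]; exists q; rewrite ?ltry ?lte_fin.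
- move=> _; have /rat_in_itvoo[q] : (y - 1 < y)%R by rewrite gtrDl ltrN10.
  by rewrite in_itv/= => /andP[_ qy]; exists q; rewrite ?ltNyr ?lte_fin.
- by move=> _; exists 0%R; rewrite ?ltNyr ?ltry.
Qed.

Lemma lte_ratP x y :
  x < y <-> exists q : rat, x <= (ratr q)%:E /\ ~ (y <= (ratr q)%:E).
Proof.
split=> [/ereal_rat_in_itvoo[q xq qy]|[q [xq /negP]]].
  by exists q; rewrite (ltW xq); split => //; apply/negP; rewrite -ltNge.
by rewrite -ltNge; exact: le_lt_trans.
Qed.

Lemma ge0_lty_fin x : 0 <= x -> x < +oo -> exists2 r, (0 <= r)%R & x = r%:E.
Proof. by case: x => [r| |]// r0 _; exists r. Qed.

Lemma lty_natP x : 0 <= x -> x < +oo <-> exists n : nat, x <= n%:R%:E.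
Proof.
move=> x0; split=> [/(ge0_lty_fin x0)[r _ ->]|[n xn]]; last first.
  by rewrite (le_lt_trans xn)// ltry.
by exists (Num.bound r); rewrite lee_fin ltW// unstable.ltr_bound.
Qed.

Lemma lee_pmulr_lt1_eq0 x r : 0 <= x -> x \is a fin_num -> 0 <= r -> r < 1 ->
  x <= r * x -> x = 0.
Proof.
case: x r => [x| |] [r| |]//; rewrite -EFinM !lee_fin lte_fin => x0 _ r0 r1 xrx.
congr EFin; apply/eqP; rewrite eq_le x0 andbT leNgt; apply/negP => x_gt0.
by move: xrx; rewrite leNgt gtr_pMl// r1.
Qed.

Definition below c (n : nat) : \bar R :=
  match c with
  | r%:E => (r - n.+1%:R^-1)%:E
  | +oo => n%:R%:E
  | -oo => -oo
  end.

Lemma below_nd c : nondecreasing_seq (below c).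
Proof.
case: c => [r| |] m n mn //=.
- by rewrite lee_fin lerD2l lerN2 lef_pV2 ?posrE// ler_nat.
- by rewrite lee_fin ler_nat.
Qed.

Lemma below_lt c n : -oo < c -> below c n < c.
Proof.
case: c => [r| |] //= _; last by rewrite ltry.
by rewrite lte_fin gtrDl oppr_lt0 invr_gt0.
Qed.

Lemma below_le c n : below c n <= c.
Proof.
have [->//|] := eqVneq c -oo.
by rewrite -ltNye => cN; exact/ltW/below_lt.
Qed.

Lemma below_gt c x : x < c -> exists n, x < below c n.
Proof.
case: c => [r| |] //=.
- case: x => [x| |] //; last by exists 0%N; rewrite ltNyr.
  rewrite lte_fin => /ltr_add_invr[k xk].
  by exists k; rewrite lte_fin ltrBrDr.
- case: x => [x| |] // _; last by exists 0%N; rewrite ltNyr.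
  by exists (Num.bound x); rewrite lte_fin unstable.ltr_bound.
- by rewrite ltNge leNye.
Qed.

Lemma le_below c x : (forall n, below c n <= x) -> c <= x.
Proof. by move=> h; rewrite leNgt; apply/negP => /below_gt[n]; rewrite ltNge h. Qed.

End ereal_approximation.

Section orientation.
Context {R : realType} {E : set (\bar R)}.
Implicit Types (e z : E) (b : bool) (c : \bar R).

(* Reversing the order of the line exchanges upward and downward passages:
   [dir b] is the inclusion of E in the extended reals up to this reversal. *)
Definition dir b e : \bar R := if b then - set_val e else set_val e.

Lemma dir_inj b : injective (dir b).
Proof. by case: b => x y /=; [move=> /oppe_inj|]; exact: val_inj. Qed.

Lemma dir_neg b e : dir (~~ b) e = - dir b e.
Proof. by case: b; rewrite /dir/= ?oppeK. Qed.

Lemma dir_ltN b e z : (dir (~~ b) e < dir (~~ b) z) = (dir b z < dir b e).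
Proof. by rewrite !dir_neg lteN2. Qed.

Lemma dir_leN b e z : (dir (~~ b) e <= dir (~~ b) z) = (dir b z <= dir b e).
Proof. by rewrite !dir_neg leeN2. Qed.

Lemma dir_continuous b : continuous (dir b).
Proof.
case: b => x; last exact: (@initial_continuous E (\bar R) set_val).
apply: (@continuous_comp E (\bar R) (\bar R) set_val oppe).
  exact: (@initial_continuous E (\bar R) set_val).
exact: oppe_continuous.
Qed.

Lemma near_dir_lt b e c : dir b e < c -> \forall z \near e, dir b z < c.
Proof. by move=> /open_ereal_lt'; exact: dir_continuous. Qed.

Lemma near_dir_gt b e c : c < dir b e -> \forall z \near e, c < dir b z.
Proof. by move=> /open_ereal_gt'; exact: dir_continuous. Qed.

End orientation.

Section segments.
Context {R : realType} {E : set (\bar R)}.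
Implicit Types (e z : E).

Definition segment z z' : set (\bar R) := [set y | set_val z <= y <= set_val z'].

Lemma inf_le_val e : ereal_inf E <= set_val e.
Proof. by apply: ereal_inf_lbound; exact: set_valP. Qed.

Lemma val_le_sup e : set_val e <= ereal_sup E.
Proof. by apply: ereal_sup_ubound; exact: set_valP. Qed.

Lemma inf_lt_val e : ~ E (ereal_inf E) -> ereal_inf E < set_val e.
Proof.
move=> nl; rewrite lt_neqAle inf_le_val andbT; apply/eqP => le.
by apply: nl; rewrite le; exact: set_valP.
Qed.

Lemma val_lt_sup e : ~ E (ereal_sup E) -> set_val e < ereal_sup E.
Proof.
move=> nr; rewrite lt_neqAle val_le_sup andbT; apply/eqP => er.
by apply: nr; rewrite -er; exact: set_valP.
Qed.

Lemma closed_segment z z' : closed (segment z z').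
Proof.
rewrite (_ : segment z z' =
    [set y | set_val z <= y] `&` [set y | y <= set_val z']).
  by apply: closedI; [exact: closed_ereal_le_ereal|exact: closed_ereal_ge_ereal].
by apply/seteqP; split=> y; [move/andP|move=> [zy yz']; apply/andP].
Qed.

Hypothesis nE : nearly_closed E.

Lemma closed_segmentI z z' : closed (segment z z' `&` E).
Proof.
suff -> : segment z z' `&` E =
    segment z z' `&` (E `|` [set ereal_inf E; ereal_sup E]).
  by apply: closedI => //; exact: closed_segment.
apply/seteqP; split => [y [zy Ey]|y [/andP[zy yz'] Ey]]; first by split => //; left.
split; first by rewrite /segment/= zy.
case: Ey => [//|[] ye].
  have -> : y = set_val z by apply/eqP; rewrite eq_le zy andbT ye inf_le_val.
  exact: set_valP.
have -> : y = set_val z' by apply/eqP; rewrite eq_le yz' ye val_le_sup.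
exact: set_valP.
Qed.

Lemma compact_segmentI z z' : set_val z \is a fin_num -> set_val z' \is a fin_num ->
  compact (segment z z' `&` E).
Proof.
move=> fz fz'.
have compact_EFin :
    compact (EFin @` `[fine (set_val z), fine (set_val z')]%classic).
  apply: continuous_compact; last exact: segment_compact.
  apply: continuous_subspaceT => x.
  by apply: cvg_EFin; [exact: nearW|exact: cvg_id].
apply: (subclosed_compact (@closed_segmentI z z') compact_EFin).
move=> y [/andP[zy yz'] _]; have fy : y \is a fin_num.
  by rewrite fin_real// (lt_le_trans _ zy) ?(le_lt_trans yz')
    ?ltey_eq ?ltNye_eq ?fz ?fz'.
exists (fine y); last exact: fineK.
by rewrite /= in_itv/= -!lee_fin !fineK// zy.
Qed.

Lemma closed_segment_trace z z' : closed [set e : E | segment z z' (set_val e)].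
Proof.
apply: (@preimage_closed _ _ set_val (segment z z')).
  by move=> x _; exact: (@initial_continuous E (\bar R) set_val).
exact: closed_segment.
Qed.

Lemma compact_segment_trace z z' :
  set_val z \is a fin_num -> set_val z' \is a fin_num ->
  compact [set e : E | segment z z' (set_val e)].
Proof.
move=> fz fz' F FF FK.
have FsegE : (set_val @ F) (segment z z' `&` E).
  by rewrite /nbhs/=; apply: filterS FK => e /= se; split => //; exact: set_valP.
have [y [[zyz' Ey] clF_y]] := compact_segmentI fz fz' _ FsegE.
exists (exist _ y (mem_set Ey)); split; first by [].
move=> A B FA; rewrite nbhsE/= => -[U [[V oV <-] Vy] UB].
have [||_ [[e Ae <-] Ve]] := clF_y (set_val @` A) V.
- by rewrite /nbhs/=; apply: filterS FA => e Ae; exists e.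
- by apply: open_nbhs_nbhs; split.
- by exists e; split => //; exact: UB.
Qed.

End segments.

Section cemetery_topology.
Context {R : realType} {E : set (\bar R)}.
Local Notation Ed := (cemetery E).
Implicit Types (e u v z : E) (b : bool) (c : \bar R).

Lemma nbhs_Some e (S : set E) (A : set Ed) :
  nbhs e S -> (forall z, S z -> A (Some z)) -> nbhs (Some e : Ed) A.
Proof. by move=> nS SA; suff : nbhs e (Some @^-1` A) by []; apply: filterS nS. Qed.

Lemma near_Some_dir_lt b e c : dir b e < c ->
  \forall q \near (Some e : Ed), exists2 z, q = Some z & dir b z < c.
Proof. by move=> /near_dir_lt/nbhs_Some; apply => z zc; exists z. Qed.

Lemma near_Some_dir_gt b e c : c < dir b e ->
  \forall q \near (Some e : Ed), exists2 z, q = Some z & c < dir b z.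
Proof. by move=> /near_dir_gt/nbhs_Some; apply => z zc; exists z. Qed.

Lemma near_Some_dir_ge b e : exists z,
  \forall q \near (Some e : Ed), exists2 v, q = Some v & dir b z <= dir b v.
Proof.
have [[z ze]|nz] := pselect (exists z, dir b z < dir b e).
  by exists z; apply: filterS (near_Some_dir_gt ze) => q [v -> /ltW]; exists v.
exists e; apply: (nbhs_Some (S := setT)); first exact: filterT.
move=> v _; exists v => //.
by rewrite leNgt; apply/negP => ve; apply: nz; exists v.
Qed.

Lemma near_Some_segment b e : exists z z', \forall q \near (Some e : Ed),
  exists2 v, q = Some v & dir b z <= dir b v <= dir b z'.
Proof.
have [z near_z] := near_Some_dir_ge b e.
have [z' near_z'] := near_Some_dir_ge (~~ b) e.
exists z, z'; apply: filterS2 near_z near_z' => q [v -> zv] [_ [<-]].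
by rewrite dir_leN => vz'; exists v => //; rewrite zv.
Qed.

Hypothesis nE : nearly_closed E.

Lemma near_cemetery_segment z z' : \forall q \near (None : Ed),
  forall e, q = Some e -> ~ segment z z' (set_val e).
Proof.
rewrite /prop_near1 /nbhs/=; case: pselect => El; case: pselect => Er /=.
- by move=> e.
- split => //; have z'r := open_ereal_gt' (val_lt_sup z' Er).
  apply: filterS z'r => y z'y e ey _ [<-] /andP[_].
  by rewrite ey leNgt z'y.
- split => //; have lz := open_ereal_lt' (inf_lt_val z El).
  apply: filterS lz => y yz e ey _ [<-] /andP[+ _].
  by rewrite ey leNgt yz.
- have fin e : set_val e \is a fin_num.
    rewrite fin_real// (le_lt_trans _ (inf_lt_val e El)) ?leNye//.
    by rewrite (lt_le_trans (val_lt_sup e Er))// leey.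
  exists [set e : E | segment z z' (set_val e)].
    by split; [exact: compact_segment_trace|exact: closed_segment_trace].
  by move=> q [[e /= ne <-]|->//] _ [<-].
Qed.

Lemma near_cemetery_dir b z z' : \forall q \near (None : Ed),
  forall e, q = Some e -> ~ (dir b z <= dir b e <= dir b z').
Proof.
case: b; last exact: near_cemetery_segment.
apply: filterS (near_cemetery_segment z' z) => q out e /out.
by rewrite /dir !leeN2 andbC.
Qed.

Lemma cemetery_hausdorff : hausdorff_space Ed.
Proof.
have meets_Some_None e : ~ nbhs (Some e : Ed) `#` nbhs (None : Ed).
  move=> meet; have [z [z' in_segment]] := near_Some_segment false e.
  have [q [[v -> vz] /(_ _ erefl)]] := meet _ _ in_segment (near_cemetery_dir false z z').
  by rewrite vz; exact.
have meets_not_lt e u : nbhs (Some e : Ed) `#` nbhs (Some u : Ed) ->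
    ~ (dir false e < dir false u).
  move=> meet /ereal_rat_in_itvoo[r er ru].
  have [q [[v -> vr] [_ [<-]]]] := meet _ _ (near_Some_dir_lt er) (near_Some_dir_gt ru).
  by rewrite ltNge ltW.
move=> [e|] [u|] // meet; [|by case: (meets_Some_None e)|]; last first.
  by case: (meets_Some_None u); rewrite meetsC.
congr Some; apply: (@dir_inj _ _ false); apply: contrapT => /eqP.
rewrite neq_lt => /orP[]; first exact: meets_not_lt.
by apply: meets_not_lt; rewrite meetsC.
Qed.

End cemetery_topology.

(** * Entrance times of a path *)

Section one_sided_neighborhoods.
Context {R : realType}.
Implicit Types (s t u : R) (Q : R -> Prop).

Lemma at_rightP s Q : (\forall r \near s^'+, Q r) <->
  exists2 u, (s < u)%R & forall r, (s < r < u)%R -> Q r.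
Proof.
split=> [[d /= d0 dQ]|[u su uQ]].
  exists (s + d)%R; first by rewrite ltrDl.
  move=> r /andP[sr rd]; apply: dQ => //=.
  by rewrite distrC ger0_norm ?subr_ge0 ?(ltW sr)// ltrBlDl.
near=> r; apply: uQ; apply/andP; split; near: r.
  exact: nbhs_right_gt.
exact: nbhs_right_lt.
Unshelve. all: by end_near. Qed.

Lemma at_leftP t Q : (\forall r \near t^'-, Q r) <->
  exists2 u, (u < t)%R & forall r, (u < r < t)%R -> Q r.
Proof.
split=> [[d /= d0 dQ]|[u ut uQ]].
  exists (t - d)%R; first by rewrite gtrDl oppr_lt0.
  move=> r /andP[dr rt]; apply: dQ => //=.
  by rewrite ger0_norm ?subr_ge0 ?(ltW rt)// ltrBlDl -ltrBlDr.
near=> r; apply: uQ; apply/andP; split; near: r.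
  exact: nbhs_left_gt.
exact: nbhs_left_lt.
Unshelve. all: by end_near. Qed.

Lemma at_right_rat s t Q : (s < t)%R -> (\forall r \near s^'+, Q r) ->
  exists2 q : rat, (s < ratr q < t)%R & Q (ratr q).
Proof.
move=> st /at_rightP[u su uQ].
have /rat_in_itvoo[q] : (s < Num.min t u)%R by rewrite lt_min st.
rewrite in_itv/= lt_min => /and3P[sq qt qu].
by exists q; [rewrite sq|apply: uQ; rewrite sq].
Qed.

Lemma at_left_rat s t Q : (s < t)%R -> (\forall r \near t^'-, Q r) ->
  exists2 q : rat, (s < ratr q < t)%R & Q (ratr q).
Proof.
move=> st /at_leftP[u ut uQ].
have /rat_in_itvoo[q] : (Num.max s u < t)%R by rewrite gt_max st.
rewrite in_itv/= gt_max -andbA => /and3P[sq uq qt].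
by exists q; [rewrite sq|apply: uQ; rewrite uq].
Qed.

End one_sided_neighborhoods.

Section entrance_times.
Context {R : realType} {E : set (\bar R)}.
Local Notation Ed := (cemetery E).
Implicit Types (e u v x y : E) (b : bool) (c : \bar R) (p : R -> Ed).
Implicit Types (r s t : R).

Record regular_path p : Prop := {
  path_absorbed : forall s t, (0 < s)%R -> (s <= t)%R -> p s = None -> p t = None ;
  path_right : forall t, (0 <= t)%R -> p s @[s --> t^'+] --> p t ;
  path_left : forall t, (0 < t)%R -> exists q : Ed, p s @[s --> t^'-] --> q
}.

Lemma path_alive p s t : regular_path p -> (0 < s <= t)%R -> p t <> None ->
  exists e, p s = Some e.
Proof.
move=> pP /andP[s0 st] pt; case ps: (p s) => [e|]; first by exists e.
by case: pt; exact: (path_absorbed pP s0 st ps).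
Qed.

(* Paths issued from the cemetery are given the junk value -oo, so that the
   level sets of [runsup] are measurable without discarding a null set. *)
Definition runsup b p t : \bar R :=
  ereal_sup [set y | p 0%R <> None /\
    exists s e, [/\ (0 <= s <= t)%R, p s = Some e & y = dir b e]].

(* Left limits are taken into account through the supremum: [entrance b p c] is
   the first time t such that [dir b (p t)] or [dir b (p (t-))] is at least c. *)
Definition entrance b p c : \bar R :=
  ereal_inf [set t%:E | t in [set t | (0 <= t)%R /\ c <= runsup b p t]].

Lemma runsup_ge b p s t e : p 0%R <> None -> (0 <= s <= t)%R -> p s = Some e ->
  dir b e <= runsup b p t.
Proof. by move=> p0 st pse; apply: ereal_sup_ubound; split => //; exists s, e. Qed.

Lemma runsup_ge_value b p t e : p 0%R <> None -> (0 <= t)%R -> p t = Some e ->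
  dir b e <= runsup b p t.
Proof. by move=> p0 t0; apply: runsup_ge => //; rewrite t0 lexx. Qed.

Lemma runsup_le b p t c :
  (forall s e, p 0%R <> None -> (0 <= s <= t)%R -> p s = Some e -> dir b e <= c) ->
  runsup b p t <= c.
Proof. by move=> h; apply: ge_ereal_sup => _ [p0 [s [e [st pse ->]]]]; exact: h pse. Qed.

Lemma runsup_gt b p t c : c < runsup b p t ->
  p 0%R <> None /\ exists s e, [/\ (0 <= s <= t)%R, p s = Some e & c < dir b e].
Proof.
by move=> /ereal_sup_gt[_ [p0 [s [e [st pse ->]]]] ce]; split => //; exists s, e.
Qed.

Lemma runsup_nd b p s t : (s <= t)%R -> runsup b p s <= runsup b p t.
Proof.
move=> st; apply: runsup_le => r e p0 /andP[r0 rs] pr.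
by apply: runsup_ge pr => //; rewrite r0 (le_trans rs).
Qed.

Lemma runsup0 b p e : p 0%R = Some e -> runsup b p 0 = dir b e.
Proof.
move=> p0; apply/eqP; rewrite eq_le; apply/andP; split.
  by apply: runsup_le => s u _; rewrite -eq_le => /eqP <-; rewrite p0 => -[->].
by apply: runsup_ge_value; rewrite ?p0.
Qed.

Lemma eq_entrance b p p' c : (forall s, (0 <= s)%R -> p s = p' s) ->
  entrance b p c = entrance b p' c.
Proof.
have runsup_mono q q' t : (forall s, (0 <= s)%R -> q s = q' s) ->
    runsup b q t <= runsup b q' t.
  move=> qq'; apply: runsup_le => s e q0 /andP[s0 st] qs.
  by apply: (@runsup_ge _ _ s); rewrite -?qq' ?s0.
move=> pp'; congr ereal_inf; congr image; apply/seteqP.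
by split=> t /= [t0 ct]; split=> //; apply: (le_trans ct); apply: runsup_mono => s s0;
  rewrite pp'.
Qed.

Lemma runsup_right_lt b p t c : regular_path p -> (0 <= t)%R -> runsup b p t < c ->
  exists2 s, (t < s)%R & runsup b p s < c.
Proof.
move=> pP t0 /ereal_rat_in_itvoo[x tx xc].
suff /at_rightP[s ts s_le] : \forall r \near t^'+,
    forall e, p 0%R <> None -> p r = Some e -> dir b e <= (ratr x)%:E.
  have [tm ms] := midf_lt ts; exists ((t + s) / 2)%R => //.
  apply: le_lt_trans xc; apply: runsup_le => r e p0 /andP[r0 rs] pr.
  have [rt|tr] := leP r t.
    by apply: le_trans (ltW tx); apply: runsup_ge pr => //; rewrite r0.
  by apply: (s_le r) => //; rewrite tr (le_lt_trans rs).
case pt : (p t) => [e|]; last first.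
  near=> r => e p0; have tr : (t < r)%R by near: r; exact: nbhs_right_gt.
  rewrite (path_absorbed pP _ (ltW tr) pt)// lt_neqAle t0 andbT.
  by apply/eqP => t00; apply: p0; rewrite t00.
have [p0|p0] := pselect (p 0%R = None); first exact: nearW.
have ex : dir b e < (ratr x)%:E by apply: le_lt_trans tx; exact: runsup_ge_value pt.
have pr := path_right pP t0; rewrite pt in pr.
have near_e : \forall r \near t^'+, exists2 v, p r = Some v & dir b v < (ratr x)%:E.
  exact: pr _ (near_Some_dir_lt ex).
by apply: filterS near_e => r [v -> vx] _ _ [<-]; exact: ltW.
Unshelve. all: by end_near. Qed.

Lemma entrance_ge0 b p c : 0 <= entrance b p c.
Proof. by apply: le_ereal_inf_tmp => _ [t [t0 _] <-]; rewrite lee_fin. Qed.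

Lemma entrance_le b p c t : regular_path p -> (0 <= t)%R ->
  (entrance b p c <= t%:E) = (c <= runsup b p t).
Proof.
move=> pP t0; apply/idP/idP => [Dt|ct]; last by apply: ereal_inf_lbound; exists t.
rewrite leNgt; apply/negP => /(runsup_right_lt pP t0)[s ts sc].
move: Dt; rewrite leNgt => /negP; apply.
apply: (@lt_le_trans _ _ s%:E); first by rewrite lte_fin.
apply: le_ereal_inf_tmp => _ [r [r0 cr] <-]; rewrite lee_fin leNgt.
by apply/negP => rs; move: sc; rewrite ltNge (le_trans cr)// runsup_nd// ltW.
Qed.

Lemma entrance_gt b p c t : regular_path p -> (0 <= t)%R ->
  (t%:E < entrance b p c) = (runsup b p t < c).
Proof. by move=> pP t0; rewrite !ltNge entrance_le. Qed.

Lemma entrance_gt_value b p c t e : regular_path p -> (0 <= t)%R -> p 0%R <> None ->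
  t%:E < entrance b p c -> p t = Some e -> dir b e < c.
Proof.
move=> pP t0 p0; rewrite entrance_gt// => tc pt.
by apply: le_lt_trans tc; exact: runsup_ge_value.
Qed.

Lemma entrance_nd b p c c' : c <= c' -> entrance b p c <= entrance b p c'.
Proof.
move=> cc'; apply: ereal_inf_le_tmp => _ [t [t0 ct] <-].
by exists t => //; split => //; exact: le_trans ct.
Qed.

Lemma entrance_gt0 b p c x : regular_path p -> p 0%R = Some x -> dir b x < c ->
  0 < entrance b p c.
Proof. by move=> pP p0 xc; rewrite -[0]/0%R%:E entrance_gt// (runsup0 b p0). Qed.

Lemma entrance_cvg b p c : regular_path p ->
  entrance b p (below c n) @[n --> \oo] --> entrance b p c.
Proof.
move=> pP; pose D n := entrance b p (below c n).
have D_nd : nondecreasing_seq D by move=> m n mn; exact/entrance_nd/below_nd.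
suff <- : ereal_sup (range D) = entrance b p c by exact: ereal_nondecreasing_cvgn.
have D_le n : D n <= ereal_sup (range D) by apply: ereal_sup_ubound; exists n.
apply/eqP; rewrite eq_le; apply/andP; split.
  by apply: ge_ereal_sup => _ [n _ <-]; exact/entrance_nd/below_le.
have [->|] := eqVneq (ereal_sup (range D)) +oo; first exact: leey.
rewrite -ltey => /ge0_lty_fin[|r r0 supD].
  exact: le_trans (entrance_ge0 _ _ _) (D_le 0%N).
rewrite supD entrance_le//; apply: le_below => n.
by rewrite -entrance_le// -supD; exact: D_le.
Qed.

Lemma regular_shift p t : regular_path p -> (0 <= t)%R ->
  regular_path (fun r => p (r + t)%R).
Proof.
move=> pP t0; split.
- move=> r s r0 rs; apply: (path_absorbed pP); first by rewrite ltr_wpDr.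
  by rewrite lerD2r.
- move=> r r0 A /(path_right pP (addr_ge0 r0 t0))/at_rightP[u ru uA].
  apply/at_rightP; exists (u - t)%R; first by rewrite ltrBrDr.
  by move=> s /andP[rs su]; apply: uA; rewrite ltrD2r rs -ltrBrDr.
- move=> r r0; have [q pq] := path_left pP (ltr_wpDr t0 r0).
  exists q => A /pq/at_leftP[u ur uA].
  apply/at_leftP; exists (u - t)%R; first by rewrite ltrBlDr.
  by move=> s /andP[us sr]; apply: uA; rewrite ltrD2r sr -ltrBlDr us.
Qed.

Lemma runsup_shift b p t s : p 0%R <> None -> p t <> None -> (0 <= t)%R -> (0 <= s)%R ->
  runsup b p (s + t) = maxe (runsup b p t) (runsup b (fun r => p (r + t)%R) s).
Proof.
move=> p0 pt t0 s0; apply/eqP; rewrite eq_le; apply/andP; split.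
  apply: runsup_le => r e _ /andP[r0 rts] pr; rewrite le_max.
  have [rt|tr] := leP r t.
    by apply/orP; left; apply: runsup_ge pr => //; rewrite r0.
  apply/orP; right; apply: (@runsup_ge _ _ (r - t)) => /=.
  - by rewrite add0r.
  - by rewrite subr_ge0 (ltW tr)/= lerBlDr.
  - by rewrite subrK.
rewrite ge_max runsup_nd ?lerDr//=; apply: runsup_le => r e _ /andP[r0 rs] pr.
by apply: runsup_ge pr => //; rewrite addr_ge0//= lerD2r.
Qed.

Lemma entrance_shift b p t c : regular_path p -> p 0%R <> None -> p t <> None ->
  (0 <= t)%R -> t%:E < entrance b p c ->
  entrance b p c = entrance b (fun r => p (r + t)%R) c + t%:E.
Proof.
move=> pP p0 pt t0 tc.
apply/eqP; rewrite eq_le; apply/andP; split.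
  rewrite -leeBlDr//; apply: le_ereal_inf_tmp => _ [s [s0 cs] <-].
  rewrite leeBlDr// -EFinD entrance_le// ?addr_ge0// runsup_shift//.
  by rewrite le_max cs orbT.
apply: le_ereal_inf_tmp => _ [s [s0 cs] <-].
have ts : (t <= s)%R.
  by apply: ltW; rewrite -lte_fin (lt_le_trans tc)// entrance_le.
have st0 : (0 <= s - t)%R by rewrite subr_ge0.
rewrite -leeBrDr// -EFinB entrance_le//; last exact: regular_shift.
move: cs; rewrite -[X in runsup _ _ X](subrK t s) runsup_shift// le_max => /orP[|//].
by rewrite entrance_gt// ltNge in tc; rewrite (negbTE tc).
Qed.

End entrance_times.

Section left_limits_at_entrance.
Context {R : realType} {E : set (\bar R)}.
Local Notation Ed := (cemetery E).
Implicit Types (e u v x z : E) (b : bool) (c : \bar R) (p : R -> Ed).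
Implicit Types (r s t : R).

Definition climbs b p t c :=
  forall c', c' < c -> exists2 s, (0 <= s < t)%R & c' <= runsup b p s.

Definition left_continuous_at_entrance b p c := entrance b p c < +oo ->
  p (fine (entrance b p (below c n))) @[n --> \oo] --> p (fine (entrance b p c)).

Definition adjacent_jumps p := forall t u v, (0 < t)%R ->
  p s @[s --> t^'-] --> (Some u : Ed) -> p t = Some v ->
  forall b z, ~ (dir b u < dir b z < dir b v).

Lemma climbs_entrance_cvg b p t c : regular_path p -> -oo < c ->
  entrance b p c = t%:E -> climbs b p t c ->
  fine (entrance b p (below c n)) @[n --> \oo] --> t^'-.
Proof.
move=> pP cN Dt clim; pose D n := fine (entrance b p (below c n)).
have D_lt n : (D n < t)%R.
  have [s /andP[s0 st] cs] := clim _ (below_lt n cN).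
  have Ds : entrance b p (below c n) <= s%:E by rewrite entrance_le.
  have /ge0_lty_fin[|r _ Dr] := le_lt_trans Ds (ltry s); first exact: entrance_ge0.
  by rewrite /D Dr (le_lt_trans _ st)// -lee_fin -Dr.
have D_cvg : D n @[n --> \oo] --> t.
  by have := @entrance_cvg _ _ b _ c pP; rewrite Dt => /fine_cvg.
move=> A tA; have D_left : \forall n \near \oo, (D n < t)%R -> A (D n).
  exact: (D_cvg [set r | (r < t)%R -> A r]).
suff : \forall n \near \oo, A (D n) by [].
by apply: filterS D_left => n; apply; exact: D_lt.
Qed.

Lemma climbs_left_limit b p t c q : nearly_closed E -> regular_path p -> -oo < c ->
  left_continuous_at_entrance b p c -> entrance b p c = t%:E ->
  p s @[s --> t^'-] --> q -> climbs b p t c -> p t = q.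
Proof.
move=> nE pP cN lc Dt pq clim.
have D_cvg := climbs_entrance_cvg pP cN Dt clim.
have := lc; rewrite /left_continuous_at_entrance Dt ltry => /(_ isT) p_cvg.
exact: (cvg_unique (cemetery_hausdorff nE) p_cvg (cvg_comp _ _ D_cvg pq)).
Qed.

Lemma not_climbs b p t c c' : (0 < t)%R -> c' < c ->
  (forall s, (0 <= s < t)%R -> runsup b p s < c) ->
  (\forall s \near t^'-, forall e, p s = Some e -> dir b e <= c') ->
  ~ climbs b p t c.
Proof.
move=> t0 c'c pc /at_leftP[u ut u_le] clim.
have [r ur /andP[r0 rt]] : exists2 r, (u < r)%R & (0 <= r < t)%R.
  have mt : (Num.max 0 u < t)%R by rewrite gt_max t0.
  have [mr rt] := midf_lt mt; exists ((Num.max 0 u + t) / 2)%R.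
    by apply: le_lt_trans mr; rewrite le_max lexx orbT.
  by rewrite rt andbT (le_trans _ (ltW mr))// le_max lexx.
have rc : runsup b p r < c by apply: pc; rewrite r0.
have /ereal_rat_in_itvoo[x mx xc] : maxe (runsup b p r) c' < c by rewrite gt_max rc.
have [s /andP[s0 st] xs] := clim _ xc.
move: (lt_le_trans mx xs); rewrite ltNge => /negP; apply.
apply: runsup_le => s' e p0 /andP[s'0 s's] ps'; rewrite le_max.
have [s'r|rs'] := leP s' r.
  by apply/orP; left; apply: runsup_ge ps' => //; rewrite s'0.
apply/orP; right; apply: u_le ps'.
by rewrite (lt_trans ur)//= (le_lt_trans s's).
Qed.

Lemma climbs_left_limit_ge b p t c u : (0 < t)%R ->
  (forall s, (0 <= s < t)%R -> runsup b p s < c) ->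
  p s @[s --> t^'-] --> (Some u : Ed) -> climbs b p t c -> c <= dir b u.
Proof.
move=> t0 pc pu clim; rewrite leNgt; apply/negP => /ereal_rat_in_itvoo[q uq qc].
apply: (not_climbs t0 qc pc _ clim).
have near_u : \forall s \near t^'-, exists2 z, p s = Some z & dir b z < (ratr q)%:E.
  exact: pu _ (near_Some_dir_lt uq).
by apply: filterS near_u => s [z -> zq] _ [<-]; exact: ltW.
Qed.

Lemma left_limit_le b p t c u : (0 < t)%R ->
  (forall s e, (0 <= s < t)%R -> p s = Some e -> dir b e <= c) ->
  p s @[s --> t^'-] --> (Some u : Ed) -> dir b u <= c.
Proof.
move=> t0 pc pu; rewrite leNgt; apply/negP => cu.
have /(at_left_rat t0)[q /andP[q0 qt] [e pq ce]] : \forall s \near t^'-,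
    exists2 e, p s = Some e & c < dir b e by exact: pu _ (near_Some_dir_gt cu).
by move: ce; rewrite ltNge (pc (ratr q))// (ltW q0).
Qed.

End left_limits_at_entrance.

Section value_at_entrance.
Context {R : realType} {E : set (\bar R)}.
Local Notation Ed := (cemetery E).
Hypothesis nE : nearly_closed E.
Implicit Types (e u v x y z : E) (b : bool) (c : \bar R) (p : R -> Ed).
Implicit Types (r s t : R).

Definition dirsup b : \bar R := ereal_sup (range (@dir R E b)).

Lemma None_left_limit_escape b p t y : (0 < t)%R ->
  (forall s, (0 < s < t)%R -> exists2 e, p s = Some e & dir b y < dir b e) ->
  p s @[s --> t^'-] --> (None : Ed) ->
  forall z, \forall s \near t^'-, exists2 e, p s = Some e & dir b z < dir b e.
Proof.
move=> t0 above pN z.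
have /at_leftP[r rt off_segment] : \forall s \near t^'-, forall e, p s = Some e ->
    ~ (dir b y <= dir b e <= dir b z) by exact: pN _ (near_cemetery_dir nE b y z).
apply/at_leftP; exists (Num.max 0 r)%R; first by rewrite gt_max t0.
move=> s; rewrite gt_max -andbA => /and3P[s0 rs st].
have [|e ps ye] := above s; first by rewrite s0.
exists e => //; rewrite ltNge; apply/negP => ez.
by apply: (off_segment s _ _ ps); rewrite ?rs// ez (ltW ye).
Qed.

Section escape.
Variables (b : bool) (p : R -> Ed) (t : R).
Hypotheses (t0 : (0 < t)%R) (p0 : p 0%R <> None).
Hypothesis escape : forall z,
  \forall s \near t^'-, exists2 e, p s = Some e & dir b z < dir b e.

Lemma escape_lt_dirsup z : dir b z < dirsup b.
Proof.
have [q _ [e _ ze]] := at_left_rat t0 (escape z).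
by apply: (lt_le_trans ze); apply: ereal_sup_ubound; exists e.
Qed.

Lemma escape_runsup : dirsup b <= runsup b p t.
Proof.
apply: ge_ereal_sup => _ [z _ <-].
have [q /andP[q0 qt] [e pq /ltW ze]] := at_left_rat t0 (escape z).
by apply: (le_trans ze); apply: runsup_ge pq => //; rewrite (ltW q0) ltW.
Qed.

End escape.

Lemma climbs_dirsup b p t : p 0%R <> None -> (forall z, dir b z < dirsup b) ->
  dirsup b <= runsup b p t -> climbs b p t (dirsup b).
Proof.
move=> p0 dir_lt tsup c' c'sup.
pose m := if p t is Some e then maxe c' (dir b e) else c'.
have c'm : c' <= m by rewrite /m; case: (p t) => [e|]//; rewrite le_max lexx.
have msup : m < dirsup b by rewrite /m; case: (p t) => [e|]//; rewrite gt_max c'sup dir_lt.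
have [_ [s [e [/andP[s0 st] ps me]]]] := runsup_gt (lt_le_trans msup tsup).
exists s; last by rewrite (le_trans (le_trans c'm (ltW me)))// runsup_ge_value.
rewrite s0 lt_neqAle st andbT; apply/eqP => st'.
by move: me; rewrite /m -st' ps gt_max ltxx andbF.
Qed.

Lemma dead_at_dirsup b p x r : regular_path p ->
  left_continuous_at_entrance b p (dirsup b) -> p 0%R = Some x ->
  (forall z, dir b z < dirsup b) -> entrance b p (dirsup b) = r%:E ->
  (0 < r)%R /\ p r = None.
Proof.
move=> pP lc p0 dir_lt Dr.
have r0 : (0 < r)%R by rewrite -lte_fin -Dr (entrance_gt0 pP p0).
have before s : (0 <= s < r)%R -> runsup b p s < dirsup b.
  by move=> /andP[s0 sr]; rewrite -entrance_gt// Dr lte_fin.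
have clim : climbs b p r (dirsup b).
  by apply: climbs_dirsup => //; [rewrite p0|rewrite -entrance_le ?Dr ?(ltW r0)].
have [q pq] := path_left pP r0; split => //.
rewrite (climbs_left_limit nE pP _ lc Dr pq clim) ?(le_lt_trans (leNye _) (dir_lt x))//.
case: q pq => [u pu|//].
by have := climbs_left_limit_ge r0 before pu clim; rewrite leNgt dir_lt.
Qed.

(* If the left limit is the cemetery while the path stays above [dir b y], then
   it escapes at the upper end of E, where quasi-left-continuity kills it. *)
Lemma no_return_from_cemetery b p t x y : regular_path p ->
  left_continuous_at_entrance b p (dirsup b) -> p 0%R = Some x -> (0 < t)%R ->
  (forall s e, (0 <= s < t)%R -> p s = Some e -> dir b y < dir b e) ->
  p s @[s --> t^'-] --> (None : Ed) -> p t = None.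
Proof.
move=> pP lc p0 t0 above pN; apply: contrapT => pt.
have p0' : p 0%R <> None by rewrite p0.
have escape := None_left_limit_escape t0 _ pN.
have {}escape z : \forall s \near t^'-, exists2 e, p s = Some e & dir b z < dir b e.
  apply: (escape b y) => s /andP[s0 st].
  have [|e ps] := path_alive (s := s) pP _ pt; first by rewrite s0 ltW.
  by exists e => //; apply: above ps; rewrite (ltW s0).
have Dt : entrance b p (dirsup b) <= t%:E by rewrite entrance_le ?(ltW t0) ?escape_runsup.
have /ge0_lty_fin[|r _ Dr] := le_lt_trans Dt (ltry t); first exact: entrance_ge0.
have [r0 pr] := dead_at_dirsup pP lc p0 (escape_lt_dirsup t0 escape) Dr.
by apply: pt; apply: path_absorbed pr => //; rewrite -lee_fin -Dr.
Qed.

Lemma climbs_value b p t x y : regular_path p ->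
  left_continuous_at_entrance b p (dir b y) -> p 0%R = Some x -> dir b x < dir b y ->
  entrance b p (dir b y) = t%:E -> (0 < t)%R -> climbs b p t (dir b y) -> p t = Some y.
Proof.
move=> pP lc p0 xy Dt t0 clim; have p0' : p 0%R <> None by rewrite p0.
have before s : (0 <= s < t)%R -> runsup b p s < dir b y.
  by move=> /andP[s0 st]; rewrite -entrance_gt// Dt lte_fin.
have before_lt s e : (0 <= s < t)%R -> p s = Some e -> dir b e < dir b y.
  by move=> /andP[s0 st]; apply: entrance_gt_value; rewrite // Dt lte_fin.
have [q pq] := path_left pP t0.
rewrite (climbs_left_limit nE pP (le_lt_trans (leNye _) xy) lc Dt pq clim).
case: q pq => [u pu|pN].
  congr Some; apply: (@dir_inj _ _ b); apply/eqP; rewrite eq_le.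
  rewrite (climbs_left_limit_ge t0 before pu clim) andbT.
  by apply: left_limit_le t0 _ pu => s e st /(before_lt _ _ st)/ltW.
exfalso; apply: (not_climbs t0 xy before _ clim).
have /at_leftP[r rt off_segment] : \forall s \near t^'-, forall e, p s = Some e ->
    ~ (dir b x <= dir b e <= dir b y) by exact: pN _ (near_cemetery_dir nE b x y).
apply/at_leftP; exists (Num.max 0 r)%R; first by rewrite gt_max t0.
move=> s; rewrite gt_max -andbA => /and3P[s0 rs st] e ps.
rewrite leNgt; apply/negP => xe; apply: (off_segment s _ _ ps); first by rewrite rs.
by rewrite (ltW xe) ltW// (before_lt s)// (ltW s0).
Qed.

Lemma not_climbs_jump b p t c : p 0%R <> None -> c <= runsup b p t -> ~ climbs b p t c ->
  exists c', [/\ c' < c, forall s e, (0 <= s < t)%R -> p s = Some e -> dir b e <= c' &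
    exists2 v, p t = Some v & c <= dir b v].
Proof.
move=> p0 ct /existsNP[c' /not_implyP[c'c /forall2NP nclim]].
have before s e : (0 <= s < t)%R -> p s = Some e -> dir b e <= c'.
  move=> st ps; apply: (@le_trans _ _ (runsup b p s)).
    by apply: runsup_ge_value => //; case/andP: st.
  by case: (nclim s) => // /negP; rewrite -ltNge => /ltW.
exists c'; split => //.
have [_ [s [v [/andP[s0 st] ps c'v]]]] := runsup_gt (lt_le_trans c'c ct).
have {}st : s = t.
  apply/eqP; rewrite eq_le st leNgt; apply/negP => st'.
  by move: c'v; rewrite ltNge (before s)// s0.
rewrite st in ps; exists v => //; rewrite leNgt; apply/negP => vc.
move: ct; rewrite leNgt => /negP; apply.
apply: (@le_lt_trans _ _ (maxe c' (dir b v))); last by rewrite gt_max c'c.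
apply: runsup_le => s' e' _ /andP[s'0]; rewrite le_eqVlt => /orP[/eqP ->|s't] ps'.
  by move: ps'; rewrite ps => -[->]; rewrite le_max lexx orbT.
by rewrite le_max (before s')// s'0.
Qed.

Lemma value_at_entrance b p t x y : regular_path p -> adjacent_jumps p ->
  left_continuous_at_entrance b p (dir b y) ->
  left_continuous_at_entrance (~~ b) p (dirsup (~~ b)) ->
  p 0%R = Some x -> dir b x < dir b y -> entrance b p (dir b y) = t%:E ->
  (0 < t)%R /\ p t = Some y.
Proof.
move=> pP adj lc lcN p0 xy Dt; have p0' : p 0%R <> None by rewrite p0.
have t0 : (0 < t)%R by rewrite -lte_fin -Dt (entrance_gt0 pP p0).
split => //; have [|nclim] := pselect (climbs b p t (dir b y)).
  exact: climbs_value lc p0 xy Dt t0.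
have yt : dir b y <= runsup b p t by rewrite -entrance_le ?Dt ?(ltW t0).
have [c' [c'y before [v pv yv]]] := not_climbs_jump p0' yt nclim.
have [[u|] pq] := path_left pP t0.
  have uc' : dir b u <= c' by exact: left_limit_le t0 before pq.
  have /negP := adj _ _ _ t0 pq pv b y; rewrite (le_lt_trans uc' c'y)/= -leNgt => vy.
  by rewrite pv; congr Some; apply: (@dir_inj _ _ b); apply/eqP; rewrite eq_le vy.
suff : p t = None by rewrite pv.
apply: (no_return_from_cemetery (b := ~~ b) (y := y) pP lcN p0 t0 _ pq) => s e st ps.
by rewrite dir_ltN; exact: le_lt_trans (before _ _ st ps) c'y.
Qed.

End value_at_entrance.

(** * Measurability *)

Section sigma_algebra_predicates.
Context {T : Type} (M : set (set T)) (sM : sigma_algebra setT M).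
Implicit Types (A B : set T) (Q : Prop).

Lemma sigma_algebra_not A : M A -> M [set w | ~ A w].
Proof. by case: sM => _ sC _ /sC; rewrite setTD. Qed.

Lemma sigma_algebra_const Q : M [set _ | Q].
Proof.
have M0 : M set0 by case: sM.
have [q|nq] := pselect Q.
  rewrite (_ : mkset _ = [set w | ~ (@set0 T) w]); first exact: sigma_algebra_not.
  by apply/seteqP; split => w //= _.
by rewrite (_ : mkset _ = set0)//; apply/seteqP; split.
Qed.

Lemma sigma_algebra_exists (I : countType) (A : I -> set T) : (forall i, M (A i)) ->
  M [set w | exists i, A i w].
Proof.
move=> MA; pose F n := if unpickle n is Some i then A i else set0.
have -> : [set w | exists i, A i w] = \bigcup_n F n.
  apply/seteqP; split => [w [i Ai]|w [n _]].
    by exists (pickle i) => //; rewrite /F pickleK.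
  by rewrite /F; case: unpickle => // i Ai; exists i.
by case: sM => M0 _; apply => n; rewrite /F; case: unpickle.
Qed.

Lemma sigma_algebra_or A B : M A -> M B -> M [set w | A w \/ B w].
Proof.
move=> MA MB; rewrite (_ : mkset _ = [set w | exists b : bool, (if b then A else B) w]).
  by apply: sigma_algebra_exists => -[].
apply/seteqP; split => [w [Aw|Bw]|w [[] ?]].
- by exists true.
- by exists false.
- by left.
- by right.
Qed.

Lemma sigma_algebra_and A B : M A -> M B -> M [set w | A w /\ B w].
Proof.
move=> MA MB; rewrite (_ : mkset _ = [set w | ~ (~ A w \/ ~ B w)]).
  by apply/sigma_algebra_not/sigma_algebra_or; exact: sigma_algebra_not.
by apply/seteqP; split => w /=; rewrite not_orE !notK.
Qed.

Lemma sigma_algebra_imply A B : M A -> M B -> M [set w | A w -> B w].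
Proof.
move=> MA MB; rewrite (_ : mkset _ = [set w | ~ A w \/ B w]).
  by apply: sigma_algebra_or => //; exact: sigma_algebra_not.
by apply/funext => w; exact: implyE.
Qed.

Lemma sigma_algebra_forall (I : countType) (A : I -> set T) : (forall i, M (A i)) ->
  M [set w | forall i, A i w].
Proof.
move=> MA; rewrite (_ : mkset _ = [set w | ~ (exists i, ~ A i w)]).
  by apply/sigma_algebra_not/sigma_algebra_exists => i; exact: sigma_algebra_not.
by apply/funext => w; rewrite /mkset existsNE notK.
Qed.

Lemma sigma_algebra_guard_and Q A : (Q -> M A) -> M [set w | Q /\ A w].
Proof.
move=> MA; have [q|nq] := pselect Q.
  by apply: sigma_algebra_and; [exact: sigma_algebra_const|exact: MA].
rewrite (_ : mkset _ = [set w | False]); first exact: sigma_algebra_const.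
by apply/seteqP; split => w //= [].
Qed.

Lemma sigma_algebra_guard_imply Q A : (Q -> M A) -> M [set w | Q -> A w].
Proof.
move=> MA; have [q|nq] := pselect Q.
  by apply: sigma_algebra_imply; [exact: sigma_algebra_const|exact: MA].
rewrite (_ : mkset _ = [set w | True]); first exact: sigma_algebra_const.
by apply/seteqP; split => w //= _ /nq.
Qed.

End sigma_algebra_predicates.

Section almost_everywhere_comparison.
Context d (T : measurableType d) (R : realType) (mu : {measure set T -> \bar R}).
Local Notation cmu := (@completed_measure_extension _ _ _ mu).
Local Notation cT := (caratheodory_type (mu^*)%mu).
Implicit Types A B C : set T.

(* Instances of [filterS], [filterS2] and [filterI]: on the path space, the
   filter instance of [almost_everywhere] is not found by unification. *)
Lemma ae_filterS A B : A `<=` B -> {ae mu, forall w, A w} -> {ae mu, forall w, B w}.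
Proof. by move=> AB; apply: filterS => w /AB. Qed.

Lemma ae_filterS2 A B C : (forall w, A w -> B w -> C w) ->
  {ae mu, forall w, A w} -> {ae mu, forall w, B w} -> {ae mu, forall w, C w}.
Proof. by move=> ABC; apply: filterS2 => w; exact: ABC. Qed.

Lemma ae_filterI A B : {ae mu, forall w, A w} -> {ae mu, forall w, B w} ->
  {ae mu, forall w, A w /\ B w}.
Proof. exact: filterI. Qed.

Lemma negligible_exists (I : countType) (A : I -> set T) :
  (forall i, mu.-negligible (A i)) -> mu.-negligible [set w | exists i, A i w].
Proof.
move=> nA; pose F n := if unpickle n is Some i then A i else set0.
apply: (@negligibleS _ _ _ _ (\bigcup_n F n)).
  by move=> w [i Ai]; exists (pickle i) => //; rewrite /F pickleK.
apply: negligible_bigcup => n; rewrite /F; case: unpickle => //.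
exact: negligible_set0.
Qed.

Lemma completed_measureE A : measurable A -> cmu A = mu A.
Proof. exact: measurable_mu_extE. Qed.

Lemma negligible_caratheodory A : mu.-negligible A -> measurable (A : set cT).
Proof.
move=> [N [mN N0 AN]]; apply: measure_is_complete_caratheodory; exists N; split=> //.
- exact: caratheodory_measurable_mu_ext.
- by rewrite -N0; exact: completed_measureE.
Qed.

Lemma completed_ae A : {ae mu, forall w, A w} -> {ae cmu, forall w, A w}.
Proof.
move=> [N [mN N0 AN]]; exists N; split=> //.
- exact: caratheodory_measurable_mu_ext.
- by rewrite -N0; exact: completed_measureE.
Qed.

Lemma completed_ae_le A B : {ae mu, forall w, A w -> B w} -> cmu A <= cmu B.
Proof.
move=> [N [mN N0 AN]]; apply: (@le_trans _ _ (cmu (B `|` N))).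
  apply: le_mu_ext => w Aw.
  by have [Bw|Bw] := pselect (B w); [left|right; apply: AN => /= /(_ Aw)].
apply: le_trans (outer_measureU2 _ B N) _.
by rewrite [X in _ + X](completed_measureE mN) N0 adde0.
Qed.

Lemma completed_ae_eq A B : {ae mu, forall w, A w <-> B w} -> cmu A = cmu B.
Proof.
move=> AB; apply/eqP; rewrite eq_le.
by rewrite !completed_ae_le//; apply: filterS AB => w; case.
Qed.

Lemma measure_ae_eq A B : measurable A -> measurable B ->
  {ae mu, forall w, A w <-> B w} -> mu A = mu B.
Proof. by move=> mA mB; rewrite -!completed_measureE//; exact: completed_ae_eq. Qed.

Lemma ae_notP A : measurable A -> {ae mu, forall w, ~ A w} <-> mu A = 0.
Proof. by move=> mA; rewrite -negligibleP// -[X in mu.-negligible X]setCK. Qed.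

(* The subset S of full outer measure in A need not be measurable. *)
Lemma ae_sub_full_outer (S A B : set T) : measurable A -> measurable B ->
  mu A < +oo -> S `<=` A -> S `<=` B -> cmu S = mu A ->
  {ae mu, forall w, A w -> B w}.
Proof.
move=> mA mB Aoo SA SB SE; have mAB := measurableI A B mA mB.
have ABE : mu (A `&` B) = mu A.
  apply/eqP; rewrite eq_le; apply/andP; split.
    by apply: le_measure; rewrite ?inE//; exact: subIsetl.
  rewrite -SE -completed_measureE//; apply: le_mu_ext => w Sw.
  by split; [exact: SA|exact: SB].
have /negligibleP nAB : mu (A `\` B) = 0.
  by rewrite measureD// [X in _ - X]ABE subee// ge0_fin_numE.
by apply: (negligibleS _ (nAB (measurableD mA mB))) => w /= /not_implyP.
Qed.

End almost_everywhere_comparison.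

Section probability_kernels.
Context d d' (S : measurableType d) (T : measurableType d') (R : realType).
Variable k : R.-pker S ~> T.
Implicit Types (x : S) (A : set T).

Lemma pkernel_le1 x A : measurable A -> k x A <= 1.
Proof. by move=> mA; rewrite -(prob_kernel (s := k) x) le_measure ?inE. Qed.

Lemma pkernel_fin_num x A : measurable A -> k x A \is a fin_num.
Proof. exact: (finite_kernel_measure k). Qed.

Lemma pkernel_setC x A : measurable A -> k x (~` A) = 1 - k x A.
Proof.
move=> mA; have finA := pkernel_fin_num x mA.
rewrite -(prob_kernel (s := k) x) -(setvU A) measureU ?setICl ?addeK//.
exact: measurableC.
Qed.

Lemma pkernel_ae1 x A : measurable A -> k x A = 1 -> {ae k x, forall w, A w}.
Proof.
move=> mA A1; have /negligibleP : k x (~` A) = 0 by rewrite pkernel_setC// A1 subee.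
by apply; exact: measurableC.
Qed.

Lemma pkernel_measure1 x A : measurable A -> {ae k x, forall w, A w} -> k x A = 1.
Proof.
move=> mA aeA; rewrite -(prob_kernel (s := k) x); apply: measure_ae_eq => //.
by apply: filterS aeA => w Aw; split.
Qed.

End probability_kernels.

Section borel_cemetery_generation.
Context {R : realType} {E : set (\bar R)}.
Local Notation Ed := (cemetery E).
Implicit Types (e z : E) (b : bool) (c : \bar R) (q : Ed).

Definition ray b c : set Ed := [set q | exists2 e, q = Some e & c < dir b e].

Lemma open_ray b c : open (ray b c).
Proof.
by rewrite openE => _ [e -> ce]; rewrite /interior; exact: near_Some_dir_gt.
Qed.

Lemma measurable_ray b c : measurable (ray b c : set (borel_cemetery E)).
Proof. by apply: sub_sigma_algebra; exact: open_ray. Qed.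

Lemma set1_NoneE : [set None] = [set q | ~ (ray false -oo q \/ ray true -oo q)].
Proof.
apply/seteqP; split => [_ -> /= [] []//|[e|]//= ne]; exfalso; apply: ne.
have [eN|eN] := eqVneq (set_val e) -oo.
  by right; exists e => //; rewrite /dir eN.
by left; exists e => //; rewrite /dir ltNye.
Qed.

Lemma sigma_algebra_None (M : set (set Ed)) : sigma_algebra setT M ->
  (forall b c, M (ray b c)) -> M [set None].
Proof.
move=> sM Mray; rewrite set1_NoneE; apply: (sigma_algebra_not sM).
by apply: (sigma_algebra_or sM); exact: Mray.
Qed.

Lemma set1_SomeE e : [set Some e] = [set q | ~ (q = None) /\
  ~ (ray false (dir false e) q \/ ray true (dir true e) q)].
Proof.
apply/seteqP; split => [_ ->|[v|] [//= _ ne]].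
  by split => // -[] [_ [<-]]; rewrite ltxx.
congr Some; apply: (@dir_inj _ _ false); apply: contrapT => /eqP.
rewrite neq_lt => /orP[|] ve; apply: ne; [right|left]; exists v => //.
by rewrite (dir_ltN false).
Qed.

Lemma measurable_set1_cemetery q : measurable ([set q] : set (borel_cemetery E)).
Proof.
have sB := sigma_algebra_measurable (borel_cemetery E).
have mNone : measurable ([set None] : set (borel_cemetery E)).
  by apply: sigma_algebra_None => // b c; exact: measurable_ray.
case: q => [e|//]; rewrite set1_SomeE; apply: (sigma_algebra_and sB).
  exact: (sigma_algebra_not sB mNone).
by apply: (sigma_algebra_not sB); apply: (sigma_algebra_or sB); exact: measurable_ray.
Qed.

Let above_rat b (i : option rat) e : bool :=
  if i is Some r then (ratr r)%:E < dir b e else true.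

Let nbhs_above_rat e (S : set E) : nbhs e S -> exists i : option rat * option rat,
  [/\ above_rat false i.1 e, above_rat true i.2 e &
    forall z, above_rat false i.1 z -> above_rat true i.2 z -> S z].
Proof.
rewrite nbhsE => -[_ [[V oV <-] Ve] VS].
have : nbhs (set_val e) V by exact: open_nbhs_nbhs.
case eE : (set_val e) => [y| |] => [[d /= d0 dV]|[M [_ MV]]|[M [_ MV]]].
- have /ereal_rat_in_itvoo[q1 yq1 q1y] : (y - d)%:E < y%:E.
    by rewrite lte_fin gtrDl oppr_lt0.
  have /ereal_rat_in_itvoo[q2 yq2 q2y] : (- (y + d))%:E < (- y)%:E.
    by rewrite lte_fin ltrN2 ltrDl.
  exists (Some q1, Some q2); rewrite /above_rat /dir eE; split => // z.
  case zE : (set_val z) => [x| |]//= q1x q2x; apply: VS; rewrite /= zE; apply: dV => /=.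
  rewrite !lte_fin in yq1 q1x yq2 q2x.
  by rewrite ltr_distlC (lt_trans yq1 q1x) -ltrN2 (lt_trans yq2 q2x).
- have /ereal_rat_in_itvoo[q Mq qoo] : M%:E < +oo by rewrite ltry.
  exists (Some q, None); rewrite /above_rat /dir eE; split => // z qz _.
  by apply: VS; apply: MV; exact: lt_trans qz.
- have /ereal_rat_in_itvoo[q Mq qoo] : (- M)%:E < +oo by rewrite ltry.
  exists (None, Some q); rewrite /above_rat /dir eE; split => // z _ qz.
  by apply: VS; apply: MV; rewrite -lteN2; exact: lt_trans qz.
Qed.

Lemma borel_cemetery_sub (M : set (set Ed)) : sigma_algebra setT M ->
  (forall b c, M (ray b c)) -> <<s @open Ed >> `<=` M.
Proof.
move=> sM Mray; apply: smallest_sub => // U oU.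
have MN : M [set None] by exact: sigma_algebra_None.
pose half b i : set Ed := [set q | exists2 e, q = Some e & above_rat b i e].
have Mhalf b i : M (half b i).
  case: i => [r|]; first exact: Mray.
  rewrite (_ : half b None = [set q | ~ (q = None)]); first exact: (sigma_algebra_not sM).
  by apply/seteqP; split => [_ [e ->]|[e|]//= _]; last by exists e.
rewrite (_ : U = [set q | (U None /\ q = None) \/ exists i : option rat * option rat,
    half false i.1 `&` half true i.2 `<=` U /\ (half false i.1 q /\ half true i.2 q)]).
  apply: (sigma_algebra_or sM).
    exact: (sigma_algebra_guard_and sM (A := [set None])).
  apply: (sigma_algebra_exists sM) => i; apply: (sigma_algebra_guard_and sM) => _.
  exact: (sigma_algebra_and sM).
apply/seteqP; split=> [[e|] Uq|q]; [right|by left|].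
  have /nbhs_above_rat[i [i1 i2 iU]] : nbhs e (Some @^-1` U).
    by have : nbhs (Some e : Ed) U by exact: open_nbhs_nbhs.
  exists i; split; last by split; exists e.
  by move=> q [[z -> z1] [_ [<-] z2]]; exact: iU.
by move=> [[UN ->]//|[i [iU half_q]]]; exact: iU.
Qed.

End borel_cemetery_generation.

Section entrance_measurability.
Context {R : realType} {E : set (\bar R)} {Omega : pointedType}.
Local Notation Ed := (cemetery E).
Variable X : \bar R -> Omega -> Ed.
Implicit Types (b : bool) (c : \bar R) (s t : R) (w : Omega).

Definition trajectory w : R -> Ed := fun t => X t%:E w.

Definition entry b c w : \bar R := entrance b (trajectory w) c.

Lemma measurable_coordinate (s : \bar R) (B : set (borel_cemetery E)) : 0 <= s ->
  measurable B -> measurable ([set w | B (X s w)] : set (path_space X)).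
Proof.
move=> s0 mB; apply: sub_sigma_algebra; exists s => //=; last by exists B.
by rewrite s0 leey.
Qed.

Lemma measurable_coordinate_eq t (q : Ed) : (0 <= t)%R ->
  measurable ([set w | X t%:E w = q] : set (path_space X)).
Proof.
move=> t0; apply: (@measurable_coordinate t%:E [set q]); first by rewrite lee_fin.
exact: measurable_set1_cemetery.
Qed.

Hypothesis regX : forall w, regular_path (trajectory w).

Lemma runsup_ratP b c t w : (0 <= t)%R ->
  c <= runsup b (trajectory w) t <-> c = -oo \/ (X 0 w <> None /\
    forall n, ray b (below c n) (X t%:E w) \/ exists q : rat,
      (0 <= (ratr q : R) <= t)%R /\ ray b (below c n) (X (ratr q)%:E w)).
Proof.
move=> t0; split=> [ct|[->|[X0 h]]]; last 2 first.
- exact: leNye.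
- apply: le_below => n; case: (h n) => [[e Xt /ltW ne]|[q [qt [e Xq /ltW ne]]]].
    by apply: (le_trans ne); exact: runsup_ge_value.
  by apply: (le_trans ne); exact: runsup_ge Xq.
have [->|cN] := eqVneq c -oo; [by left|right].
have lt n : below c n < runsup b (trajectory w) t.
  by apply: lt_le_trans ct; apply: below_lt; rewrite ltNye.
split; first by have [] := runsup_gt (lt 0%N).
move=> n; have [_ [s [e [/andP[s0]]]]] := runsup_gt (lt n).
rewrite le_eqVlt => /orP[/eqP -> Xt ne|st Xs ne]; [by left; exists e|right].
have near_s : \forall r \near s^'+, ray b (below c n) (X r%:E w).
  have Xright := path_right (regX w) s0; rewrite Xs in Xright.
  exact: (Xright _ (near_Some_dir_gt ne)).
have [q /andP[sq qt] Xq] := at_right_rat st near_s.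
by exists q; rewrite (le_trans s0 (ltW sq)) ltW.
Qed.

Lemma sigma_algebra_entry (M : set (set Omega)) b c t : sigma_algebra setT M ->
  (0 <= t)%R ->
  (forall s (B : set (borel_cemetery E)), (0 <= s <= t)%R -> measurable B ->
    M [set w | B (X s%:E w)]) ->
  M [set w | entry b c w <= t%:E].
Proof.
move=> sM t0 MX; rewrite (_ : mkset _ = [set w | c = -oo \/ (X 0 w <> None /\
  forall n, ray b (below c n) (X t%:E w) \/ exists q : rat,
    (0 <= (ratr q : R) <= t)%R /\ ray b (below c n) (X (ratr q)%:E w))]); last first.
  by apply/seteqP; split=> w /=; rewrite /entry entrance_le// runsup_ratP.
apply: (sigma_algebra_or sM); first exact: (sigma_algebra_const sM).
apply: (sigma_algebra_and sM).
  apply: (sigma_algebra_not sM); apply: (MX 0%R [set None]); first by rewrite lexx.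
  exact: measurable_set1_cemetery.
apply: (sigma_algebra_forall sM) => n; apply: (sigma_algebra_or sM).
  by apply: MX; [rewrite t0 lexx|exact: measurable_ray].
apply: (sigma_algebra_exists sM) => q; apply: (sigma_algebra_guard_and sM) => qt.
by apply: MX => //; exact: measurable_ray.
Qed.

Lemma measurable_entry_le b c t :
  measurable ([set w | entry b c w <= t%:E] : set (path_space X)).
Proof.
have [t0|t0] := leP 0%R t.
  apply: sigma_algebra_entry => //; first exact: sigma_algebra_measurable.
  by move=> s B /andP[s0 _]; apply: measurable_coordinate; rewrite lee_fin.
rewrite (_ : mkset _ = set0); first exact: measurable0.
apply/seteqP; split => w //=.
by rewrite leNgt (lt_le_trans _ (entrance_ge0 _ _ _))// lte_fin.
Qed.

Lemma measurable_entry_lt b c b' c' :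
  measurable ([set w | entry b c w < entry b' c' w] : set (path_space X)).
Proof.
have sP := sigma_algebra_measurable (path_space X).
rewrite (_ : mkset _ = [set w | exists q : rat, entry b c w <= (ratr q)%:E /\
    ~ (entry b' c' w <= (ratr q)%:E)]); last by apply/seteqP; split => w /= /lte_ratP.
apply: (sigma_algebra_exists sP) => q; apply: (sigma_algebra_and sP).
  exact: measurable_entry_le.
by apply: (sigma_algebra_not sP); exact: measurable_entry_le.
Qed.

End entrance_measurability.

(** * Filtrations and stopping times *)

Section filtrations.
Context {R : realType} {E : set (\bar R)} {Omega : pointedType}.
Local Notation Ed := (cemetery E).
Variables (X : \bar R -> Omega -> Ed) (P : R.-pker (borel_cemetery E) ~> (path_space X)).
Implicit Types (A N : set Omega) (s t : \bar R) (w : Omega).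
Implicit Types (mu : probability (borel_cemetery E) R) (B : set (borel_cemetery E)).

Lemma filtration_sigma_algebra t : sigma_algebra setT (filtration P t).
Proof.
have sG mu := smallest_sigma_algebra setT (cylinders X t `|` (mixture P mu).-negligible).
split=> [mu|A FA mu|A FA mu]; case: (sG mu) => s0 sC sU //.
- exact: (sC _ (FA mu)).
- by apply: sU => n; exact: FA.
Qed.

Lemma filtration_coordinate s t B : 0 <= s <= t ->
  measurable B -> filtration P t [set w | B (X s w)].
Proof.
move=> st mB mu; apply: sub_sigma_algebra; left; exists s => //.
by exists B.
Qed.

Lemma filtration_nd s t : s <= t -> filtration P s `<=` filtration P t.
Proof.
move=> st A FA mu; apply: sub_sigma_algebra2 (FA mu) => B [|]; last by right.
move=> [r /andP[r0 rs] [C mC <-]]; left; exists r; last by exists C.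
by rewrite /= r0 (le_trans rs).
Qed.

Lemma filtration_negligible t A :
  (forall mu, (mixture P mu).-negligible A) -> filtration P t A.
Proof. by move=> nA mu; apply: sub_sigma_algebra; right. Qed.

Lemma filtration_iff_outside t A A' N : filtration P t A ->
  (forall mu, (mixture P mu).-negligible N) ->
  (forall w, ~ N w -> (A w <-> A' w)) -> filtration P t A'.
Proof.
move=> FA nN AA'; have sF := filtration_sigma_algebra t.
rewrite (_ : A' = [set w | (~ N w /\ A w) \/ (N w /\ A' w)]).
  apply: (sigma_algebra_or sF).
    apply: (sigma_algebra_and sF) => //; apply: (sigma_algebra_not sF).
    exact: filtration_negligible.
  by apply: filtration_negligible => mu; apply: negligibleS (nN mu) => w [].
apply/seteqP; split=> w; last by move=> [[/AA'[+ _] Aw]|[]//]; exact.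
by have [Nw|Nw] := pselect (N w); [right|left; split=> //; exact/AA'].
Qed.

Lemma filtration_measurable t A mu : filtration P t A ->
  measurable (A : set (caratheodory_type (mu_ext (mixture P mu)))).
Proof.
suff FM : <<s cylinders X t `|` (mixture P mu).-negligible >> `<=`
    @measurable _ (caratheodory_type (mu_ext (mixture P mu))).
  by move=> /(_ mu); exact: FM.
apply: smallest_sub.
  exact: (sigma_algebra_measurable (caratheodory_type (mu_ext (mixture P mu)))).
move=> N [[s /andP[s0 _] [C mC <-]]|]; last exact: negligible_caratheodory.
by apply: caratheodory_measurable_mu_ext; exact: measurable_coordinate.
Qed.

Lemma mixture_negligible mu A : measurable (A : set (path_space X)) ->
  (forall q, P q A = 0) -> (mixture P mu).-negligible A.
Proof.
by move=> mA A0; apply/negligibleP => //; apply: integral0_eq => q _; exact: A0.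
Qed.

End filtrations.

Section stopping_times.
Context {R : realType} {E : set (\bar R)} {Omega : pointedType}.
Local Notation Ed := (cemetery E).
Variables (X : \bar R -> Omega -> Ed) (P : R.-pker (borel_cemetery E) ~> (path_space X)).
Implicit Types (A : set Omega) (t u : \bar R) (w : Omega) (T : Omega -> \bar R).
Implicit Types (mu : probability (borel_cemetery E) R).

Lemma cst_stopping_time t : 0 <= t -> stopping_time P (fun=> t).
Proof.
move=> t0; split=> [w //|u u0].
exact: (sigma_algebra_const (filtration_sigma_algebra _ _)).
Qed.

Lemma stopped_filtration_cst t A : filtration P t A -> stopped_filtration P (fun=> t) A.
Proof.
move=> FA u u0; have sF := filtration_sigma_algebra P u.
rewrite (_ : A `&` _ = [set w | t <= u /\ A w]).
  by apply: (sigma_algebra_guard_and sF) => /filtration_nd; apply.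
by apply/seteqP; split=> w [].
Qed.

Section fixed_stopping_time.
Variable T : Omega -> \bar R.
Hypothesis stT : stopping_time P T.

Lemma stopped_filtration_sigma_algebra : sigma_algebra setT (stopped_filtration P T).
Proof.
have sF := filtration_sigma_algebra P; split=> [t t0|A FA t t0|A FA t t0].
- by rewrite set0I; case: (sF t).
- rewrite [X in filtration P t X](_ : _ = [set w | T w <= t /\
      ~ (A `&` [set w | T w <= t]) w]).
    apply: (sigma_algebra_and (sF t)); first exact: stT.2.
    exact: (sigma_algebra_not (sF t) (FA t t0)).
  apply/seteqP; split => w /=; first by move=> [[_ nA] Tt]; split => // -[].
  by move=> [Tt nA]; split => //; split => // Aw; exact: nA.
- rewrite setI_bigcupl; case: (sF t) => _ _; apply => n; exact: FA.
Qed.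

Lemma stopped_filtration_restrict A u t : stopped_filtration P T A -> u <= t ->
  filtration P t (A `&` [set w | T w <= u]).
Proof.
move=> FA ut; have [u0|u0] := leP 0 u; first by apply: (filtration_nd ut); exact: FA.
rewrite (_ : A `&` _ = [set w | False]).
  exact: (sigma_algebra_const (filtration_sigma_algebra P t)).
apply/seteqP; split=> w //= [_ Tu]; have := stT.1 w.
by rewrite leNgt (le_lt_trans Tu).
Qed.

Lemma stopping_time_le u t : u <= t -> filtration P t [set w | T w <= u].
Proof.
move=> ut; rewrite -[X in filtration P t X]setTI; apply: stopped_filtration_restrict => //.
exact: (sigma_algebra_const stopped_filtration_sigma_algebra True).
Qed.

Lemma stopping_time_lt u t : u <= t -> filtration P t [set w | T w < u].
Proof.
move=> ut; have sF := filtration_sigma_algebra P t.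
rewrite (_ : mkset _ = [set w | exists q : rat, (ratr q)%:E < u /\ T w <= (ratr q)%:E]).
  apply: (sigma_algebra_exists sF) => q; apply: (sigma_algebra_guard_and sF) => qu.
  by apply: stopping_time_le; exact: le_trans (ltW qu) ut.
apply/seteqP; split=> w /=; last by move=> [q [qs Tq]]; exact: le_lt_trans Tq qs.
by move=> /ereal_rat_in_itvoo[q Tq qs]; exists q; split => //; exact: ltW.
Qed.

Lemma stopped_filtration_le u : stopped_filtration P T [set w | T w <= u].
Proof.
move=> t t0; rewrite (_ : _ `&` _ = [set w | T w <= mine u t]).
  by apply: stopping_time_le; rewrite ge_min lexx orbT.
by apply/seteqP; split=> w /=; rewrite le_min => /andP.
Qed.

Lemma stopped_filtration_measurable A mu : stopped_filtration P T A ->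
  measurable (A : set (caratheodory_type (mu_ext (mixture P mu)))).
Proof.
move=> /(_ +oo); rewrite (_ : [set w | T w <= +oo] = setT).
  by rewrite setIT => FA; apply: filtration_measurable; exact: FA.
by apply/seteqP; split => w //= _; rewrite leey.
Qed.

Section shift.
Variable s : R.
Hypothesis s0 : (0 <= s)%R.

Let shift_leE t : [set w | T w + s%:E <= t] = [set w | T w <= t - s%:E].
Proof. by apply/funext => w; rewrite /mkset leeBrDr. Qed.

Let sub_le t : t - s%:E <= t. Proof. by rewrite leeBlDr// leeDl// lee_fin. Qed.

Lemma stopping_time_shift : stopping_time P (fun w => T w + s%:E).
Proof.
split=> [w|t t0]; first by rewrite adde_ge0// ?stT.1// lee_fin.
by rewrite shift_leE; exact: stopping_time_le (sub_le t).
Qed.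

Lemma stopped_filtration_shift A : stopped_filtration P T A ->
  stopped_filtration P (fun w => T w + s%:E) A.
Proof.
by move=> FA t t0; rewrite shift_leE; exact: stopped_filtration_restrict FA (sub_le t).
Qed.

End shift.

End fixed_stopping_time.

Lemma stopped_filtration_lt T T' : stopping_time P T -> stopping_time P T' ->
  stopped_filtration P T [set w | T w < T' w].
Proof.
move=> stT stT' t t0; have sF := filtration_sigma_algebra P t.
rewrite [X in filtration P t X](_ : _ = [set w | T w <= t /\ (~ (T' w <= t) \/
    exists q : rat, (ratr q)%:E <= t /\ (T w <= (ratr q)%:E /\ ~ (T' w <= (ratr q)%:E)))]).
  apply: (sigma_algebra_and sF); first exact: stT.2.
  apply: (sigma_algebra_or sF); first by apply: (sigma_algebra_not sF); exact: stT'.2.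
  apply: (sigma_algebra_exists sF) => q; apply: (sigma_algebra_guard_and sF) => qt.
  apply: (sigma_algebra_and sF); first exact: stopping_time_le.
  by apply: (sigma_algebra_not sF); exact: stopping_time_le.
apply/seteqP; split=> w /=.
  move=> [TT' Tt]; split => //; have [T't|T't] := leP (T' w) t; last by left.
  right; have [q [Tq qT']] := (lte_ratP _ _).1 TT'; exists q; split => //.
  by apply: le_trans T't; rewrite leNgt; apply/negP => /ltW.
move=> [Tt [/negP|[q [_ TqT']]]]; last by split=> //; apply/lte_ratP; exists q.
by rewrite -ltNge => tT'; split=> //; exact: le_lt_trans tT'.
Qed.

End stopping_times.

Section hunt_filtration.
Context {R : realType} {E : set (\bar R)} {Omega : pointedType}.
Local Notation Ed := (cemetery E).
Variables (X : \bar R -> Omega -> Ed) (theta : \bar R -> Omega -> Omega).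
Variable P : R.-pker (borel_cemetery E) ~> (path_space X).
Hypothesis HX : hunt_process theta P.
Implicit Types (b : bool) (c : \bar R) (s t : R) (w : Omega) (q : Ed).
Implicit Types (B : set (borel_cemetery E)) (T : Omega -> \bar R).

Lemma hunt_regular w : regular_path (trajectory X w).
Proof.
split.
- move=> s t s0 st Xs; apply: (hunt_absorbing HX).
    by rewrite lee_fin (le_trans (ltW s0)).
  apply: (@le_trans _ _ s%:E); last by rewrite lee_fin.
  by apply: ereal_inf_lbound.
- by move=> t t0; exact: (hunt_right_continuous HX).
- by move=> t t0; exact: (hunt_left_limit HX).
Qed.

Lemma entry_stopping_time b c : stopping_time P (entry X b c).
Proof.
split=> [w|[t| |]//]; first exact: entrance_ge0.
  move=> t0; apply: sigma_algebra_entry => //; first exact: hunt_regular.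
    exact: filtration_sigma_algebra.
  by move=> s B st; apply: filtration_coordinate; rewrite !lee_fin.
move=> _; rewrite (_ : mkset _ = [set w | True]).
  exact: (sigma_algebra_const (filtration_sigma_algebra _ _)).
by apply/seteqP; split => w //= _; rewrite leey.
Qed.

Lemma initial_value_ae q : {ae P q, forall w, X 0 w = q}.
Proof.
apply: pkernel_ae1 (hunt_normal HX q).
exact: (@measurable_coordinate_eq _ _ _ X 0%R q (lexx _)).
Qed.

(* Absorption is only postulated after positive times. *)
Let resurrected : set Omega :=
  [set w | X 0 w = None /\ exists q : rat, (0 < (ratr q : R))%R /\ X (ratr q)%:E w <> None].

Let resurrected_negligible mu : (mixture P mu).-negligible resurrected.
Proof.
have sP := sigma_algebra_measurable (path_space X).
have m_eq t q : (0 <= t)%R -> measurable ([set w | X t%:E w = q] : set (path_space X)).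
  exact: measurable_coordinate_eq.
have mres : measurable (resurrected : set (path_space X)).
  apply: (sigma_algebra_and sP); first exact: (m_eq 0%R).
  apply: (sigma_algebra_exists sP) => q; apply: (sigma_algebra_guard_and sP) => q0.
  by apply: (sigma_algebra_not sP); apply: m_eq; exact: ltW.
apply: mixture_negligible => // -[e|]; apply/(ae_notP _ mres).
  by apply: ae_filterS (initial_value_ae (Some e)) => w X0 [XN _]; rewrite XN in X0.
suff : {ae P None, forall w,
    forall q : rat, (0 < (ratr q : R))%R -> X (ratr q)%:E w = None}.
  by apply: ae_filterS => w dead [_ [q [q0]]]; apply; exact: dead.
have n_alive (q : rat) : (P None).-negligible
    [set w | ~ ((0 < (ratr q : R))%R -> X (ratr q)%:E w = None)].
  have [q0|q0] := boolP (0 < (ratr q : R))%R; last first.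
    by apply: negligibleS (negligible_set0 _) => w /=; apply.
  have q0' : 0 <= (ratr q : R)%:E by rewrite lee_fin ltW.
  have := pkernel_ae1 (m_eq _ None (ltW q0)) (hunt_cemetery HX q0').
  by apply: negligibleS => w /= nX XN; exact: nX.
by apply: negligibleS (negligible_exists n_alive) => w /existsNP.
Qed.

(* By right-continuity, a path lies in an open ray at time u iff it lies in a smaller
   one at all rational times shortly after u. *)
Let right_in_ray b c t (u : \bar R) (p : R -> Ed) : Prop :=
  exists z : rat, c < (ratr z)%:E /\ exists d : rat, (0 < (ratr d : R))%R /\
    forall q : rat, (0 <= (ratr q : R) <= t)%R -> u < (ratr q)%:E ->
      ~ (u <= (ratr q - ratr d)%:E) -> ray b (ratr z)%:E (p (ratr q)).

Let ray_rightP b c (p : R -> Ed) s t : regular_path p -> (0 <= s < t)%R ->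
  (p s = None -> forall r, (s < r)%R -> p r = None) ->
  ray b c (p s) <-> right_in_ray b c t s%:E p.
Proof.
move=> pP /andP[s0 st] stays_dead; have p_right := path_right pP s0; split.
  move=> [e ps /ereal_rat_in_itvoo[z cz ze]]; exists z; split => //.
  rewrite ps in p_right.
  have /at_rightP[u su uz] : \forall r \near s^'+, ray b (ratr z)%:E (p r).
    exact: (p_right _ (near_Some_dir_gt ze)).
  have /rat_in_itvoo[d] : (0 < u - s)%R by rewrite subr_gt0.
  rewrite in_itv/= ltrBrDl => /andP[d0 du]; exists d; split=> // q _.
  rewrite lte_fin lee_fin => sq /negP; rewrite -ltNge ltrBlDr => qd.
  by apply: uz; rewrite sq (lt_trans qd).
move=> [z [cz [d [d0 in_ray]]]].
have std : (s < Num.min t (s + ratr d))%R by rewrite lt_min st ltrDl.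
have {}in_ray (q : rat) : (s < ratr q < Num.min t (s + ratr d))%R ->
    ray b (ratr z)%:E (p (ratr q)).
  rewrite lt_min => /and3P[sq qt qd]; apply: in_ray; last 2 first.
  - by rewrite lte_fin.
  - by apply/negP; rewrite lee_fin -ltNge ltrBlDr.
  - by rewrite (le_trans s0 (ltW sq)) ltW.
case ps : (p s) => [e|]; last first.
  have /rat_in_itvoo[q] := std; rewrite in_itv/= => sq.
  by have [v] := in_ray q sq; rewrite (stays_dead ps)//; case/andP: sq.
exists e => //; rewrite ltNge; apply/negP => ec; rewrite ps in p_right.
have near_e : \forall r \near s^'+, exists2 v, p r = Some v & dir b v < (ratr z)%:E.
  exact: (p_right _ (near_Some_dir_lt (le_lt_trans ec cz))).
have [q sq [v pv vz]] := at_right_rat std near_e.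
by have [v'] := in_ray q sq; rewrite pv => -[<-]; rewrite ltNge (ltW vz).
Qed.

Let not_resurrected_absorbed w s r : ~ resurrected w -> (0 <= s)%R -> (s < r)%R ->
  X s%:E w = None -> X r%:E w = None.
Proof.
move=> alive s0 sr Xs; have [s00|s_neq0] := eqVneq s 0%R; last first.
  by apply: (path_absorbed (hunt_regular w) _ (ltW sr) Xs); rewrite lt_neqAle eq_sym s_neq0.
have /rat_in_itvoo[q] := sr; rewrite in_itv/= s00 => /andP[q0 qr].
apply: (path_absorbed (hunt_regular w) q0 (ltW qr)); apply: contrapT => Xq.
by apply: alive; split; [rewrite -Xs s00|exists q].
Qed.

Section stopped_coordinate.
Variable T : Omega -> \bar R.
Hypothesis stT : stopping_time P T.

Let filtration_right_in_ray b c t :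
  filtration P t%:E [set w | right_in_ray b c t (T w) (trajectory X w)].
Proof.
have sF := filtration_sigma_algebra P t%:E.
apply: (sigma_algebra_exists sF) => z; apply: (sigma_algebra_guard_and sF) => _.
apply: (sigma_algebra_exists sF) => d; apply: (sigma_algebra_guard_and sF) => d0.
apply: (sigma_algebra_forall sF) => q.
apply: (sigma_algebra_guard_imply sF) => /andP[q0 qt].
apply: (sigma_algebra_imply sF); first by apply: stopping_time_lt; rewrite ?lee_fin.
apply: (sigma_algebra_imply sF).
  apply: (sigma_algebra_not sF); apply: stopping_time_le; rewrite ?lee_fin//.
  by rewrite (le_trans _ qt)// gerBl ltW.
by apply: filtration_coordinate; rewrite ?lee_fin ?q0//; exact: measurable_ray.
Qed.

Let stopped_ray_fin b c t : (0 <= t)%R ->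
  filtration P t%:E [set w | ray b c (X (T w) w) /\ T w <= t%:E].
Proof.
move=> t0; have sF := filtration_sigma_algebra P t%:E.
pose in_ray w := (~ T w < t%:E /\ ray b c (X t%:E w)) \/
  (T w < t%:E /\ right_in_ray b c t (T w) (trajectory X w)).
pose A := [set w | T w <= t%:E /\ in_ray w].
apply: (@filtration_iff_outside _ _ _ _ _ _ A _ resurrected _ resurrected_negligible).
  apply: (sigma_algebra_and sF); first exact: stopping_time_le.
  apply: (sigma_algebra_or sF); apply: (sigma_algebra_and sF).
  - by apply: (sigma_algebra_not sF); exact: stopping_time_lt.
  - by apply: filtration_coordinate; rewrite ?lee_fin ?t0 ?lexx//; exact: measurable_ray.
  - exact: stopping_time_lt.
  - exact: filtration_right_in_ray.
move=> w alive; suff in_rayE : T w <= t%:E -> (in_ray w <-> ray b c (X (T w) w)).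
  by split=> [[Tt]|[+ Tt]] => /(in_rayE Tt).
rewrite /in_ray => Tt; have [Tlt|Tge] := boolP (T w < t%:E); last first.
  have -> : T w = t%:E by apply/eqP; rewrite eq_le Tt leNgt.
  by split=> [[[]//|[]//]|?]; left.
have [s s0 Ts] := ge0_lty_fin (stT.1 w) (lt_trans Tlt (ltry t)).
rewrite Ts lte_fin in Tlt *.
have st : (0 <= s < t)%R by rewrite s0.
have stays_dead : trajectory X w s = None -> forall r, (s < r)%R -> trajectory X w r = None.
  by move=> Xs r sr; exact: not_resurrected_absorbed alive s0 sr Xs.
rewrite -[X s%:E w]/(trajectory X w s) (ray_rightP b c (hunt_regular w) st stays_dead).
by split=> [[[]//|[]//]|?]; right.
Qed.

Let stopped_ray b c : stopped_filtration P T [set w | ray b c (X (T w) w)].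
Proof.
case=> [t|_|]//; first exact: stopped_ray_fin.
have sF := filtration_sigma_algebra P +oo.
rewrite [X in filtration P _ X](_ : _ = [set w | exists n : nat,
    ray b c (X (T w) w) /\ T w <= n%:R%:E]).
  apply: (sigma_algebra_exists sF) => n; apply: (@filtration_nd _ _ _ _ P n%:R%:E).
    exact: leey.
  exact: stopped_ray_fin.
apply/seteqP; split => w /=; last by move=> [n [Xw _]]; split => //; rewrite leey.
move=> [Xw _]; have : T w != +oo.
  by apply/eqP => Too; move: Xw => []; rewrite Too (hunt_infty HX).
by rewrite -ltey => /(lty_natP (stT.1 w))[n Tn]; exists n.
Qed.

Lemma stopped_coordinate B : measurable B ->
  stopped_filtration P T [set w | B (X (T w) w)].
Proof.
have sT := stopped_filtration_sigma_algebra stT.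
have sM := sigma_algebra_image (fun w => X (T w) w) sT.
move=> /(borel_cemetery_sub sM); rewrite /image_set_system /= setTI; apply => b c.
by rewrite /= setTI; exact: stopped_ray.
Qed.

End stopped_coordinate.
End hunt_filtration.
(** * The strong Markov property on path space *)

Section restricted_law.
Context d d' (T : measurableType d) (Y : measurableType d') (R : realType).
Variables (m : {measure set T -> \bar R}) (A : set T) (f : T -> Y).
Hypotheses (mA : measurable A) (mf : measurable_fun setT f).

Definition restricted_law : {measure set Y -> \bar R}.
Proof.
unshelve refine (pushforward (mrestr m mA) f : {measure set Y -> \bar R}).
exact: mf.
Defined.

Lemma restricted_lawE B : restricted_law B = m (A `&` f @^-1` B).
Proof. by rewrite /= /pushforward /mrestr setIC. Qed.

Lemma ge0_integral_mrestr (g : T -> \bar R) :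
  measurable_fun setT g -> (forall x, 0 <= g x) ->
  \int[mrestr m mA]_x g x = \int[m]_(x in A) g x.
Proof.
move=> mg g0; have mAC := measurableC mA.
rewrite -(setUCr A) ge0_integral_setU//; last 2 first.
- by rewrite setUCr.
- exact/disj_setPCl.
rewrite [X in _ + X]null_set_integral//; last 2 first.
- exact: measurable_funTS.
- by rewrite /= /mrestr setICl measure0.
rewrite adde0; apply: eq_measure_integral => B mB BA.
by rewrite /= /mrestr setIidl.
Qed.

Lemma ge0_integral_restricted_law (phi : Y -> \bar R) :
  measurable_fun setT phi -> (forall y, 0 <= phi y) ->
  \int[restricted_law]_y phi y = \int[m]_(w in A) phi (f w).
Proof.
move=> mphi phi0; rewrite -ge0_integral_mrestr//; last exact: measurableT_comp.
by have := ge0_integral_pushforward mf (mrestr m mA) measurableT mphi (fun y _ => phi0 y);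
  rewrite preimage_setT.
Qed.

End restricted_law.

Section strong_markov.
Context {R : realType} {E : set (\bar R)} {Omega : pointedType}.
Local Notation Ed := (cemetery E).
Variables (X : \bar R -> Omega -> Ed) (theta : \bar R -> Omega -> Omega).
Variable P : R.-pker (borel_cemetery E) ~> (path_space X).
Hypothesis HX : hunt_process theta P.
Implicit Types (s t u : R) (w : Omega) (A G : set Omega) (T : Omega -> \bar R).
Implicit Types (B C : set (borel_cemetery E)) (mu nu : probability (borel_cemetery E) R).
Local Notation Pc mu := (@completed_measure_extension _ _ _ (mixture P mu)).
Local Notation cT mu := (caratheodory_type (mu_ext (mixture P mu))).

Lemma completed_mixture_le1 mu A : Pc mu A <= 1.
Proof.
have <- : Pc mu setT = 1.
  transitivity (mixture P mu [set: path_space X]); first exact: completed_measureE.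
  exact: probability_setT.
exact: le_mu_ext.
Qed.

Lemma completed_mixture_fin_num mu A : Pc mu A \is a fin_num.
Proof.
by rewrite ge0_fin_numE ?measure_ge0// (le_lt_trans (completed_mixture_le1 mu A))// ltry.
Qed.

Lemma mixture_initial_law nu B : measurable B -> mixture P nu [set w | B (X 0 w)] = nu B.
Proof.
move=> mB; transitivity (\int[nu]_z (\1_B z)%:E); last by rewrite integral_indic// setIT.
apply: eq_integral => z _; rewrite indicE.
have mXB : measurable ([set w | B (X 0 w)] : set (path_space X)).
  exact: measurable_coordinate.
have [Bz|nBz] := boolP (z \in B).
  apply: pkernel_measure1 => //.
  by apply: ae_filterS (initial_value_ae HX z) => w /= ->; exact: set_mem.
apply/(ae_notP _ mXB); apply: ae_filterS (initial_value_ae HX z) => w /= -> Bz.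
by move/negP: nBz; apply; exact: mem_set.
Qed.

Lemma measurable_stopped_coordinate mu T : stopping_time P T ->
  measurable_fun setT (fun w : cT mu => X (T w) w : borel_cemetery E).
Proof.
move=> stT _ B mB; rewrite setTI.
exact: (stopped_filtration_measurable mu (stopped_coordinate HX stT mB)).
Qed.

Section stopped_law.
Variables (mu : probability (borel_cemetery E) R) (T : Omega -> \bar R) (A : set Omega).
Hypotheses (stT : stopping_time P T) (FA : stopped_filtration P T A).

Definition stopped_law : {measure set (borel_cemetery E) -> \bar R} :=
  restricted_law (Pc mu) (stopped_filtration_measurable mu FA)
    (@measurable_stopped_coordinate mu T stT).

Lemma stopped_lawE B : stopped_law B = Pc mu (A `&` [set w | B (X (T w) w)]).
Proof. exact: restricted_lawE. Qed.

Lemma ge0_integral_stopped_law (phi : borel_cemetery E -> \bar R) :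
  measurable_fun setT phi -> (forall z, 0 <= phi z) ->
  \int[stopped_law]_z phi z = \int[Pc mu]_(w in A) phi (X (T w) w).
Proof. exact: ge0_integral_restricted_law. Qed.

Lemma strong_markov_coordinate s B : (0 <= s)%R -> measurable B ->
  Pc mu (A `&` [set w | B (X (T w + s%:E) w)]) =
  \int[stopped_law]_z P z [set w | B (X s%:E w)].
Proof.
move=> s0 mB; rewrite ge0_integral_stopped_law//; last first.
  by apply: measurable_kernel; apply: measurable_coordinate; rewrite ?lee_fin.
exact: (hunt_strong_markov HX).
Qed.

End stopped_law.

Definition cylinder_after T (ts : seq R) (Bs : R -> set (borel_cemetery E)) : set Omega :=
  [set w | forall t, t \in ts -> Bs t (X (T w + t%:E) w)].

Lemma cylinder_after_nil T Bs : cylinder_after T [::] Bs = setT.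
Proof. by apply/seteqP; split. Qed.

Lemma cylinder_after_cons T t ts Bs : cylinder_after T (t :: ts) Bs =
  [set w | Bs t (X (T w + t%:E) w)] `&` cylinder_after T ts Bs.
Proof.
apply/seteqP; split=> w => [cyl|[Bt cyl] s].
  by split=> [|s sts]; apply: cyl; rewrite inE ?sts ?orbT ?eqxx.
by rewrite inE => /orP[/eqP ->|/cyl].
Qed.

Section proportional_laws.
Variables (mu1 mu2 : probability (borel_cemetery E) R) (k : {nonneg R}).

Definition proportional_laws T1 A1 T2 A2 : Prop :=
  forall B : set (borel_cemetery E), measurable B ->
  Pc mu1 (A1 `&` [set w | B (X (T1 w) w)]) =
  k%:num%:E * Pc mu2 (A2 `&` [set w | B (X (T2 w) w)]).

Lemma proportional_laws_shift T1 A1 T2 A2 s T1' T2' B :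
  stopping_time P T1 -> stopped_filtration P T1 A1 ->
  stopping_time P T2 -> stopped_filtration P T2 A2 ->
  proportional_laws T1 A1 T2 A2 -> (0 <= s)%R ->
  (forall w, T1' w = T1 w + s%:E) -> (forall w, T2' w = T2 w + s%:E) -> measurable B ->
  proportional_laws T1' (A1 `&` [set w | B (X (T1' w) w)])
                    T2' (A2 `&` [set w | B (X (T2' w) w)]).
Proof.
move=> stT1 FA1 stT2 FA2 prop s0 /funext-> /funext-> mB C mC; rewrite -!setIA.
have mBC : measurable (B `&` C) by exact: measurableI.
rewrite [LHS](strong_markov_coordinate mu1 stT1 FA1 s0 mBC).
rewrite [X in _ = _ * X](strong_markov_coordinate mu2 stT2 FA2 s0 mBC).
rewrite -ge0_integral_mscale//; last first.
  by apply: measurable_kernel; apply: measurable_coordinate; rewrite ?lee_fin.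
by apply: eq_measure_integral => D mD _; rewrite [LHS]stopped_lawE prop// -stopped_lawE.
Qed.

Lemma proportional_laws_cylinder T1 A1 T2 A2 u ts Bs :
  stopping_time P T1 -> stopping_time P T2 -> (0 <= u)%R ->
  stopped_filtration P (fun w => T1 w + u%:E) A1 ->
  stopped_filtration P (fun w => T2 w + u%:E) A2 ->
  proportional_laws (fun w => T1 w + u%:E) A1 (fun w => T2 w + u%:E) A2 ->
  path <=%R u ts -> (forall t, measurable (Bs t)) ->
  Pc mu1 (A1 `&` cylinder_after T1 ts Bs) =
  k%:num%:E * Pc mu2 (A2 `&` cylinder_after T2 ts Bs).
Proof.
move=> stT1 stT2 + + + + + mBs.
elim: ts u A1 A2 => [|t ts IH] u A1 A2 u0 FA1 FA2 prop.
  by rewrite !cylinder_after_nil => _; exact: (prop setT measurableT).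
rewrite /= => /andP[ut tts]; have tu0 : (0 <= t - u)%R by rewrite subr_ge0.
have shiftE (r : \bar R) : r + t%:E = r + u%:E + (t - u)%:E.
  by rewrite -addeA -EFinD subrKC.
have stopped_step T A : stopping_time P T ->
    stopped_filtration P (fun w => T w + u%:E) A ->
    stopped_filtration P (fun w => T w + t%:E) (A `&` [set w | Bs t (X (T w + t%:E) w)]).
  move=> stT FA; have t0 : (0 <= t)%R := le_trans u0 ut.
  have stTt := stopping_time_shift stT t0.
  apply: (sigma_algebra_and (stopped_filtration_sigma_algebra stTt)).
    under eq_fun do rewrite shiftE; apply: stopped_filtration_shift => //.
    exact: stopping_time_shift.
  exact: (stopped_coordinate HX stTt (mBs t)).
rewrite !cylinder_after_cons !setIA; apply: (IH t) => //.
- exact: le_trans ut.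
- exact: stopped_step.
- exact: stopped_step.
- apply: (proportional_laws_shift _ FA1 _ FA2 prop tu0) => //.
  + exact: stopping_time_shift.
  + exact: stopping_time_shift.
Qed.

End proportional_laws.
Definition finite_cylinder : set_system Omega := [set G | exists ts Bs,
  [/\ forall t, t \in ts -> (0 <= t)%R, forall t, measurable (Bs t) &
      G = cylinder_after (fun=> 0) ts Bs]].

Lemma measurable_finite_cylinder G : finite_cylinder G ->
  measurable (G : set (path_space X)).
Proof.
move=> [ts [Bs [+ mBs ->]]]; elim: ts => [|t ts IH] ts0.
  by rewrite cylinder_after_nil; exact: measurableT.
rewrite cylinder_after_cons; apply: measurableI; last first.
  by apply: IH => s sts; apply: ts0; rewrite inE sts orbT.
by apply: measurable_coordinate => //; rewrite add0e lee_fin ts0// inE eqxx.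
Qed.

Lemma finite_cylinder_setI : setI_closed finite_cylinder.
Proof.
move=> _ _ [ts [Bs [ts0 mBs ->]]] [us [Cs [us0 mCs ->]]].
exists (ts ++ us), (fun t => (if t \in ts then Bs t else setT) `&`
  (if t \in us then Cs t else setT)); split.
- by move=> t; rewrite mem_cat => /orP[/ts0|/us0].
- by move=> t; apply: measurableI; case: ifPn.
apply/seteqP; split => [w [cyl_ts cyl_us] t _|w cyl].
  by split; [case: ifPn => // /cyl_ts|case: ifPn => // /cyl_us].
by split=> t tts; have := cyl t; rewrite mem_cat tts ?orbT => /(_ isT) [].
Qed.

Lemma finite_cylinder_generate : @measurable _ (path_space X) = <<s finite_cylinder >>.
Proof.
apply/seteqP; split; apply: smallest_sub.
- exact: smallest_sigma_algebra.
- have sM := smallest_sigma_algebra setT finite_cylinder.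
  move=> _ [s /andP[s0 _] [B mB <-]]; case: s s0 => [s| |]// s0.
    apply: sub_sigma_algebra; exists [:: s], (fun=> B); split => //.
      by move=> r; rewrite inE => /eqP ->; rewrite -lee_fin.
    by rewrite cylinder_after_cons cylinder_after_nil setIT; under eq_set do rewrite add0e.
  rewrite (_ : _ @^-1` _ = [set w | B None]); first exact: (sigma_algebra_const sM).
  by apply/seteqP; split => w /=; rewrite (hunt_infty HX).
- exact: (sigma_algebra_measurable (path_space X)).
- by move=> G; exact: measurable_finite_cylinder.
Qed.

Section path_law_after_stopping_time.
Variables (mu : probability (borel_cemetery E) R) (T : Omega -> \bar R) (A : set Omega).
Hypotheses (stT : stopping_time P T) (FA : stopped_filtration P T A).

Let mass : {nonneg R} := NngNum (fine_ge0 (measure_ge0 (Pc mu) A)).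

Let massE : mass%:num%:E = Pc mu A.
Proof. by rewrite /= fineK// completed_mixture_fin_num. Qed.

Lemma shift_coordinate (u : \bar R) w : 0 <= u -> X u (theta (T w) w) = X (T w + u) w.
Proof. by move=> u0; rewrite (hunt_shift HX) ?stT.1// addeC. Qed.

Lemma shift_cylinder ts Bs : (forall t, t \in ts -> (0 <= t)%R) ->
  [set w | cylinder_after (fun=> 0) ts Bs (theta (T w) w)] = cylinder_after T ts Bs.
Proof.
move=> ts0; apply/seteqP; split=> w cyl t tts; have := cyl t tts;
  by rewrite add0e shift_coordinate// lee_fin ts0.
Qed.

Lemma measurable_shift : measurable_fun setT
  (fun w : cT mu => theta (T w) w : path_space X).
Proof.
apply: (@measurability _ _ (cT mu) (path_space X) setT _ (cylinders X +oo)) => //.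
move=> _ [_ [s /andP[s0 _] [B mB <-]] <-]; rewrite setTI.
rewrite (_ : (fun w => theta (T w) w) @^-1` _ = [set w | B (X (T w + s) w)]); last first.
  by apply/funext => w; rewrite /preimage/= shift_coordinate.
case: s s0 => [s| |]// s0.
  have stTs := stopping_time_shift stT s0.
  exact: (stopped_filtration_measurable mu (stopped_coordinate HX stTs mB)).
rewrite (_ : mkset _ = [set w | B None]).
  exact: (sigma_algebra_const (sigma_algebra_measurable (cT mu))).
apply/funext => w; rewrite /mkset addey ?(hunt_infty HX)//.
by rewrite -ltNye (lt_le_trans (ltNyr 0))// stT.1.
Qed.

Section prescribed_law.
Variable nu : probability (borel_cemetery E) R.
Hypothesis law_nu : forall B : set (borel_cemetery E), measurable B ->
  Pc mu (A `&` [set w | B (X (T w) w)]) = Pc mu A * nu B.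

Let cylinder_law ts Bs : (forall t, t \in ts -> (0 <= t)%R) ->
  (forall t, measurable (Bs t)) ->
  Pc mu (A `&` cylinder_after T ts Bs) =
  Pc mu A * mixture P nu (cylinder_after (fun=> 0) ts Bs).
Proof.
move=> ts0 mBs; rewrite -massE -[mixture P nu _]completed_measureE; last first.
  by apply: measurable_finite_cylinder; exists ts, Bs.
have cyl_sort T' : cylinder_after T' ts Bs = cylinder_after T' (sort <=%R ts) Bs.
  by apply/seteqP; split=> w cyl t; rewrite ?mem_sort => tts;
    apply: cyl; rewrite ?mem_sort.
have adde0_fun (T' : Omega -> \bar R) : (fun w => T' w + 0%R%:E) = T'.
  by apply/funext => w; rewrite adde0.
rewrite !cyl_sort -[X in _ = _ * Pc nu X]setTI.
apply: (proportional_laws_cylinder (u := 0%R)); rewrite ?adde0_fun//.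
- exact: cst_stopping_time.
- exact: (sigma_algebra_const (stopped_filtration_sigma_algebra
    (cst_stopping_time P (lexx 0))) True).
- move=> B mB; rewrite law_nu// massE setTI; congr (_ * _).
  rewrite -(mixture_initial_law nu mB) completed_measureE//.
  exact: measurable_coordinate.
- rewrite path_sortedE; last exact: le_trans.
  rewrite sort_sorted ?andbT; last exact: le_total.
  by apply/allP => t; rewrite mem_sort; exact: ts0.
Qed.

Lemma strong_markov_law G : measurable (G : set (path_space X)) ->
  Pc mu (A `&` [set w | G (theta (T w) w)]) = Pc mu A * mixture P nu G.
Proof.
move=> mG; have mA := stopped_filtration_measurable mu FA.
transitivity (restricted_law (Pc mu) mA measurable_shift G).
  by rewrite restricted_lawE.
transitivity (mscale mass (mixture P nu) G); last by rewrite /mscale/= massE.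
apply: (@measure_unique _ R (path_space X) finite_cylinder (fun=> setT)
  finite_cylinder_generate finite_cylinder_setI) => //.
- by move=> _; exists [::], (fun=> setT); rewrite cylinder_after_nil.
- by rewrite bigcup_const//; exists 0%N.
- move=> _ [ts [Bs [ts0 mBs ->]]]; rewrite restricted_lawE [RHS]/= /mscale/= massE.
  by rewrite -cylinder_law// -shift_cylinder.
- move=> k; rewrite restricted_lawE.
  by rewrite (le_lt_trans (completed_mixture_le1 _ _))// ltry.
Qed.

End prescribed_law.

Lemma strong_markov_path G : measurable (G : set (path_space X)) ->
  Pc mu (A `&` [set w | G (theta (T w) w)]) = \int[Pc mu]_(w in A) P (X (T w) w) G.
Proof.
move=> mG; have mPG : measurable_fun setT (P^~ G) by exact: measurable_kernel.
pose rho := stopped_law mu stT FA.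
transitivity (\int[rho]_z P z G); last by exact: ge0_integral_stopped_law.
have rhoT : rho setT = Pc mu A by rewrite stopped_lawE setIT.
have [A0|A_neq0] := eqVneq (Pc mu A) 0.
  have -> : Pc mu (A `&` [set w | G (theta (T w) w)]) = 0.
    apply/eqP; rewrite eq_le measure_ge0 andbT -A0.
    exact: le_mu_ext.
  by rewrite null_set_integral// rhoT.
have Afin := completed_mixture_fin_num mu A.
pose nu : probability (borel_cemetery E) R := mnormalize rho mu.
have rhoE B : rho B = Pc mu A * nu B.
  rewrite /nu/= /mnormalize rhoT (negbTE A_neq0)/= (_ : (Pc mu A == +oo) = false).
    rewrite muleCA -[X in _ * (X * _)](fineK Afin) -EFinM divff ?mule1//.
    by rewrite fine_eq0.
  by apply/negbTE; rewrite -ltey -ge0_fin_numE ?measure_ge0.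
rewrite (strong_markov_law (nu := nu))//; last by move=> B _; rewrite -rhoE stopped_lawE.
rewrite -massE /mixture -ge0_integral_mscale//.
by apply: eq_measure_integral => B mB _; rewrite [RHS]rhoE [LHS]/= /mscale/= massE.
Qed.

End path_law_after_stopping_time.
End strong_markov.

Section initial_point.
Context {R : realType} {E : set (\bar R)} {Omega : pointedType}.
Local Notation Ed := (cemetery E).
Variables (X : \bar R -> Omega -> Ed) (theta : \bar R -> Omega -> Omega).
Variable P : R.-pker (borel_cemetery E) ~> (path_space X).
Implicit Types (A G H : set Omega) (q : Ed) (c : \bar R) (T : Omega -> \bar R).
Local Notation Pc mu := (@completed_measure_extension _ _ _ (mixture P mu)).
Local Notation cT mu := (caratheodory_type (mu_ext (mixture P mu))).
Local Notation start q := (\d_(q : borel_cemetery E) : probability (borel_cemetery E) R).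

Lemma mixture_dirac q A : measurable (A : set (path_space X)) ->
  mixture P (start q) A = P q A.
Proof.
move=> mA; rewrite /mixture integral_dirac//; last exact: measurable_kernel.
by rewrite diracT mul1e.
Qed.

Lemma ae_mixture_dirac q A :
  {ae mixture P (start q), forall w, A w} <-> {ae P q, forall w, A w}.
Proof.
by split=> -[N [mN N0 AN]]; exists N; split => //; rewrite -N0 mixture_dirac.
Qed.

Lemma completed_mixture_dirac q A : measurable (A : set (path_space X)) ->
  Pc (start q) A = P q A.
Proof. by move=> mA; rewrite -mixture_dirac//; exact: completed_measureE. Qed.

Hypothesis HX : hunt_process theta P.

Section strong_markov_event.
Variables (q : Ed) (T : Omega -> \bar R) (A G H : set Omega) (c : \bar R).
Hypotheses (stT : stopping_time P T) (FA : stopped_filtration P T A).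
Hypothesis mA : measurable (A : set (path_space X)).
Hypothesis mG : measurable (G : set (path_space X)).
Hypothesis mH : measurable (H : set (path_space X)).

Let mPG : measurable_fun (A : set (cT (start q))) (fun w : cT (start q) => P (X (T w) w) G).
Proof.
apply: measurable_funTS.
apply: (measurableT_comp (f := P^~ G)); first exact: measurable_kernel.
exact: (measurable_stopped_coordinate HX stT).
Qed.

Let integral_cst_event :
  \int[Pc (start q)]_(w in (A : set (cT (start q)))) cst c w = c * P q A.
Proof.
have mA' := stopped_filtration_measurable (start q) FA.
by rewrite integral_cst//; congr (_ * _); exact: completed_mixture_dirac.
Qed.

Lemma strong_markov_le : 0 <= c ->
  {ae P q, forall w, A w -> P (X (T w) w) G <= c} ->
  {ae P q, forall w, H w -> A w /\ G (theta (T w) w)} ->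
  P q H <= c * P q A.
Proof.
move=> c0 PGc HAG; have mA' := stopped_filtration_measurable (start q) FA.
rewrite -completed_mixture_dirac// -integral_cst_event.
apply: (@le_trans _ _ (Pc (start q) (A `&` [set w | G (theta (T w) w)]))).
  exact/completed_ae_le/ae_mixture_dirac.
rewrite (strong_markov_path HX)//; apply: ae_ge0_le_integral => //.
exact/completed_ae/ae_mixture_dirac.
Qed.

Lemma strong_markov_eq : {ae P q, forall w, A w -> P (X (T w) w) G = c} ->
  {ae P q, forall w, H w <-> A w /\ G (theta (T w) w)} ->
  P q H = c * P q A.
Proof.
move=> PGc HAG; have mA' := stopped_filtration_measurable (start q) FA.
rewrite -completed_mixture_dirac// -integral_cst_event.
transitivity (Pc (start q) (A `&` [set w | G (theta (T w) w)])).
  exact/completed_ae_eq/ae_mixture_dirac.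
rewrite (strong_markov_path HX)//; apply: ae_eq_integral => //.
exact/completed_ae/ae_mixture_dirac.
Qed.

End strong_markov_event.
End initial_point.

(** * Exit probabilities *)

Section entry_times_of_hunt_processes.
Context {R : realType} {E : set (\bar R)} {Omega : pointedType}.
Local Notation Ed := (cemetery E).
Variables (X : \bar R -> Omega -> Ed) (theta : \bar R -> Omega -> Omega).
Variable P : R.-pker (borel_cemetery E) ~> (path_space X).
Hypothesis HX : hunt_process theta P.
Implicit Types (s t u : R) (w : Omega) (x y z : E) (q : Ed) (b : bool) (c : \bar R).

Lemma left_continuous_at_entrance_ae q b c :
  {ae P q, forall w, left_continuous_at_entrance b (trajectory X w) c}.
Proof.
apply/ae_mixture_dirac; set mu := (X in mixture P X).
have quasi_left := @hunt_quasi_left_continuous _ _ _ _ _ _ HX mu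
  (fun n => entry X b (below c n)) (entry X b c).
apply: ae_filterS (quasi_left _ _ _ _); last 4 first.
- by move=> n; exact: (entry_stopping_time HX).
- exact: (entry_stopping_time HX).
- by move=> w m n mn; exact/entrance_nd/below_nd.
- by move=> w; exact: (entrance_cvg (hunt_regular HX w)).
move=> w + Dfin => /(_ Dfin).
have fineE c' : c' <= c -> (fine (entry X b c' w))%:E = entry X b c' w.
  move=> c'c; have Dc' := le_lt_trans (entrance_nd b (trajectory X w) c'c) Dfin.
  by rewrite fineK// ge0_fin_numE ?entrance_ge0.
rewrite /trajectory fineE//; under eq_fun do rewrite -fineE ?below_le//.
exact.
Qed.

Lemma entry_theta b c w t : (0 <= t)%R -> X 0 w <> None -> X t%:E w <> None ->
  t%:E < entry X b c w -> entry X b c w = entry X b c (theta t%:E w) + t%:E.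
Proof.
move=> t0 X0 Xt tc; rewrite /entry (entrance_shift (hunt_regular HX w) X0 Xt t0 tc).
congr (_ + _); apply: eq_entrance => s s0.
by rewrite /trajectory (hunt_shift HX) ?lee_fin.
Qed.

Hypothesis sfX : skip_free P.

Lemma adjacent_jumps_ae x : {ae P (Some x), forall w, adjacent_jumps (trajectory X w)}.
Proof.
apply: ae_filterS (sfX x) => w sf t u v t0 Xu Xv b z uzv.
have lt : 0 < t%:E < lifetime X w.
  rewrite lte_fin t0 ltNge; apply/negP => /(hunt_absorbing HX).
  by rewrite lee_fin (ltW t0) => /(_ isT); rewrite -/(trajectory X w t) Xv.
have := sf t lt u v Xu Xv; rewrite -subset0 => /(_ (set_val z)); apply.
split; last exact: set_valP.
rewrite /= gt_min lt_max; case: b uzv; rewrite /dir ?lteN2 => /andP[-> ->];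
  by rewrite ?orbT.
Qed.

Hypothesis nE : nearly_closed E.

Lemma value_at_entry_ae b x y : dir b x < dir b y -> {ae P (Some x), forall w,
  forall t, entry X b (dir b y) w = t%:E -> (0 < t)%R /\ X t%:E w = Some y}.
Proof.
move=> xy; have lc_ae := left_continuous_at_entrance_ae (Some x).
apply: ae_filterS2 (ae_filterI (initial_value_ae HX (Some x)) (adjacent_jumps_ae x))
  (ae_filterI (lc_ae b (dir b y)) (lc_ae (~~ b) (@dirsup R E (~~ b)))).
move=> w [X0 adj] [lc lcN] t Dt.
exact: (value_at_entrance nE (hunt_regular HX w) adj lc lcN X0 xy Dt).
Qed.

Lemma hitting_entry_ae b x y : dir b x < dir b y -> {ae P (Some x), forall w,
  hitting X (Some y) w = entry X b (dir b y) w}.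
Proof.
move=> xy; apply: ae_filterS2 (initial_value_ae HX (Some x)) (value_at_entry_ae xy).
move=> w X0 val; apply/eqP; rewrite eq_le; apply/andP; split.
  have [->|] := eqVneq (entry X b (dir b y) w) +oo; first exact: leey.
  rewrite -ltey => /(ge0_lty_fin (entrance_ge0 _ _ _))[t t0 Dt].
  have [t0' Xt] := val _ Dt.
  by rewrite [leRHS]Dt; apply: ereal_inf_lbound.
apply: le_ereal_inf_tmp => -[t| |] [// t0 Xt]; last by rewrite (hunt_infty HX) in Xt.
rewrite lte_fin in t0.
apply: ereal_inf_lbound; exists t => //; split; first exact: ltW.
by apply: runsup_ge_value; rewrite ?(ltW t0)// /trajectory X0.
Qed.

End entry_times_of_hunt_processes.

Section skip_free_hunt_processes.
Context {R : realType} {E : set (\bar R)} {Omega : pointedType}.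
Local Notation Ed := (cemetery E).
Variables (X : \bar R -> Omega -> Ed) (theta : \bar R -> Omega -> Omega).
Variable P : R.-pker (borel_cemetery E) ~> (path_space X).
Hypotheses (nE : nearly_closed E) (sfhX : skip_free_hunt theta P).
Implicit Types (r s t : R) (w : Omega) (a x y z : E) (b : bool) (A G H : set Omega).

Let HX : hunt_process theta P. Proof. by case: sfhX. Qed.
Let sfX : skip_free P. Proof. by case: sfhX. Qed.
Let regX w : regular_path (trajectory X w). Proof. exact: (hunt_regular HX w). Qed.
Let sP := sigma_algebra_measurable (path_space X).

Definition reach b y : Omega -> \bar R := entry X b (dir b y).

Definition exits_through b a y : set Omega := [set w | reach b y w < reach (~~ b) a w].

Lemma measurable_reach_le b y t :
  measurable ([set w | reach b y w <= t%:E] : set (path_space X)).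
Proof. exact: (measurable_entry_le regX). Qed.

Lemma measurable_exits_through b a y :
  measurable (exits_through b a y : set (path_space X)).
Proof. exact: (measurable_entry_lt regX). Qed.

Lemma reach_ge0 b y w : 0 <= reach b y w.
Proof. exact: entrance_ge0. Qed.

Lemma reach_stopping_time b y : stopping_time P (reach b y).
Proof. exact: (entry_stopping_time HX). Qed.

Lemma reach_nd b y z w : dir b y <= dir b z -> reach b y w <= reach b z w.
Proof. exact: entrance_nd. Qed.

Lemma reach_gt0_ae x b y : dir b x < dir b y -> {ae P (Some x), forall w, 0 < reach b y w}.
Proof.
move=> xy; apply: ae_filterS (initial_value_ae HX (Some x)) => w X0.
exact: entrance_gt0 X0 xy.
Qed.

Lemma reach_after_ae x b z b' y : dir b x < dir b z -> dir b' x < dir b' y -> z <> y ->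
  {ae P (Some x), forall w, forall r, reach b z w = r%:E -> reach b z w <= reach b' y w ->
    r%:E < reach b' y w /\ reach b' y w = reach b' y (theta r%:E w) + r%:E}.
Proof.
move=> xz xy zy.
apply: ae_filterS2 (initial_value_ae HX (Some x)) (ae_filterI
  (value_at_entry_ae HX sfX nE xz) (value_at_entry_ae HX sfX nE xy)).
move=> w X0 [val_z val_y] r Dz; rewrite Dz => le_zy.
have [r0 Xr] := val_z _ Dz.
have lt_zy : r%:E < reach b' y w.
  rewrite lt_neqAle le_zy andbT; apply/eqP => Dy.
  by have [_] := val_y _ (esym Dy); rewrite Xr => -[].
by split => //; apply: (entry_theta HX); rewrite ?(ltW r0)// ?X0// Xr.
Qed.

Section strong_markov_at_reach.
Variables (x z : E) (b : bool) (A G H : set Omega).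
Hypotheses (xz : dir b x < dir b z) (FA : stopped_filtration P (reach b z) A).
Hypothesis mA : measurable (A : set (path_space X)).
Hypothesis mG : measurable (G : set (path_space X)).
Hypothesis mH : measurable (H : set (path_space X)).
Hypothesis A_fin : forall w, A w -> reach b z w < +oo.

Let stopped_kernel_ae : {ae P (Some x), forall w,
  A w -> P (X (reach b z w) w) G = P (Some z) G}.
Proof.
apply: ae_filterS (value_at_entry_ae HX sfX nE xz) => w val_z.
move=> /A_fin/(ge0_lty_fin (reach_ge0 _ _ _))[t _ Dz].
by have [_ Xz] := val_z _ Dz; rewrite Dz Xz.
Qed.

Lemma strong_markov_reach_le :
  {ae P (Some x), forall w, H w -> A w /\ G (theta (reach b z w) w)} ->
  P (Some x) H <= P (Some z) G * P (Some x) A.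
Proof.
apply: (strong_markov_le HX (reach_stopping_time b z) FA mA mG mH) => //.
by apply: ae_filterS stopped_kernel_ae => w + Aw => ->.
Qed.

Lemma strong_markov_reach_eq :
  {ae P (Some x), forall w, H w <-> A w /\ G (theta (reach b z w) w)} ->
  P (Some x) H = P (Some z) G * P (Some x) A.
Proof.
exact: (strong_markov_eq HX (reach_stopping_time b z) FA mA mG mH stopped_kernel_ae).
Qed.

End strong_markov_at_reach.

Lemma strong_markov_reach_time x z b s G H : dir b x < dir b z ->
  measurable (G : set (path_space X)) -> measurable (H : set (path_space X)) ->
  {ae P (Some x), forall w,
    H w -> reach b z w <= s%:E /\ G (theta (reach b z w) w)} ->
  P (Some x) H <= P (Some z) G * P (Some x) [set w | reach b z w <= s%:E].
Proof.
move=> xz mG mH; apply: strong_markov_reach_le => //.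
- exact: stopped_filtration_le (reach_stopping_time b z) _.
- exact: measurable_reach_le.
- by move=> w /= Dz; rewrite (le_lt_trans Dz)// ltry.
Qed.

Lemma exits_through_mul b a x y z :
  dir b a < dir b x -> dir b x < dir b y -> dir b y < dir b z ->
  P (Some x) (exits_through b a z) =
  P (Some x) (exits_through b a y) * P (Some y) (exits_through b a z).
Proof.
move=> ax xy yz; have xz := lt_trans xy yz; have ay := lt_trans ax xy.
have xa : dir (~~ b) x < dir (~~ b) a by rewrite dir_ltN.
have y_neq_z : y <> z by move=> yz'; rewrite yz' ltxx in yz.
have y_neq_a : y <> a by move=> ya; rewrite ya ltxx in ay.
rewrite muleC; apply: (strong_markov_reach_eq xy).
- exact: stopped_filtration_lt (reach_stopping_time b y) (reach_stopping_time (~~ b) a).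
- exact: measurable_exits_through.
- exact: measurable_exits_through.
- exact: measurable_exits_through.
- by move=> w lt; exact: lt_le_trans lt (leey _).
apply: ae_filterS2 (reach_after_ae xy xz y_neq_z) (reach_after_ae xy xa y_neq_a).
move=> w after_z after_a.
have le_yz : reach b y w <= reach b z w by exact/reach_nd/ltW.
suff shiftE : exits_through b a y w ->
    exits_through b a z w <-> exits_through b a z (theta (reach b y w) w).
  split=> [exit_z|[exit_y exit_z]]; last exact/shiftE.
  have exit_y : exits_through b a y w by exact: le_lt_trans exit_z.
  by split => //; exact/shiftE.
move=> exit_y.
have [t t0 Dy] := ge0_lty_fin (reach_ge0 b y w) (lt_le_trans exit_y (leey _)).
have [_ Dz] := after_z _ Dy le_yz; have [_ Da] := after_a _ Dy (ltW exit_y).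
by rewrite Dy /exits_through /= Dz Da lteD2rE.
Qed.

Lemma reach_le_mono b a x y t : dir b a < dir b x -> dir b x < dir b y ->
  P (Some a) [set w | reach b y w <= t%:E] <= P (Some x) [set w | reach b y w <= t%:E].
Proof.
move=> ax xy; have ay := lt_trans ax xy; have mreach := measurable_reach_le.
have x_neq_y : x <> y by move=> xy'; rewrite xy' ltxx in xy.
apply: (@le_trans _ _ (P (Some x) [set w | reach b y w <= t%:E] *
    P (Some a) [set w | reach b x w <= t%:E])); last first.
  by rewrite -[leRHS]mule1; apply: lee_wpmul2l => //; apply: pkernel_le1; exact: mreach.
apply: strong_markov_reach_time => //.
apply: ae_filterS (reach_after_ae ax ay x_neq_y) => w after_y /= yt.
have le_xy : reach b x w <= reach b y w by exact/reach_nd/ltW.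
have xt := le_trans le_xy yt; split => //.
have [r r0 Dx] := ge0_lty_fin (reach_ge0 b x w) (le_lt_trans xt (ltry _)).
have [_ Dy] := after_y _ Dx le_xy.
by rewrite Dx; apply: le_trans yt; rewrite Dy leeDl// lee_fin.
Qed.

Lemma reach_le_gt0 x b y : dir b x < dir b y ->
  exists n : nat, 0 < P (Some x) [set w | reach b y w <= n%:R%:E].
Proof.
move=> xy; have [_ _ /(_ x y) + _] := sfhX.
apply: contraPP => /forallNP unreached; apply/negP; rewrite -leNgt.
apply: (@le_trans _ _ (@completed_measure_extension _ (path_space X) _ (P (Some x)) set0)).
  apply: completed_ae_le.
  have reach_gt n : {ae P (Some x), forall w, ~ (reach b y w <= n%:R%:E)}.
    apply/(ae_notP _ (measurable_reach_le b y n%:R)); apply/eqP.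
    by rewrite eq_le measure_ge0 andbT leNgt; exact/negP/unreached.
  apply: ae_filterS2 (hitting_entry_ae HX sfX nE xy) (ae_foralln reach_gt).
  by move=> w /= -> reach_gt_w /(lty_natP (reach_ge0 b y w))[n]; exact: reach_gt_w.
by rewrite completed_measureE ?measure0.
Qed.

Lemma reach_le_lt1 x b y : dir b x < dir b y ->
  exists k : nat, P (Some x) [set w | reach b y w <= k.+1%:R^-1%:E] < 1.
Proof.
move=> xy; apply: contrapT => /forallNP immediate.
have reach_le k : {ae P (Some x), forall w, reach b y w <= k.+1%:R^-1%:E}.
  apply: (pkernel_ae1 (measurable_reach_le _ _ _)); apply/eqP; rewrite eq_le.
  rewrite pkernel_le1; last exact: measurable_reach_le.
  by rewrite leNgt; exact/negP/immediate.
have false_ae := ae_filterS2 _ (reach_gt0_ae xy) (ae_foralln reach_le).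
suff /(ae_notP _ measurableT) P0 : {ae P (Some x), forall w, ~ [set: path_space X] w}.
  by have := prob_kernel (s := P) (Some x); rewrite P0 => /eqP; rewrite eq_sym onee_eq0.
apply: false_ae => w Dpos Dle _; have : 0 <= - reach b y w.
  by apply: le_below => k; rewrite /= sub0r EFinN leeN2.
by rewrite oppe_ge0 leNgt Dpos.
Qed.

Lemma reach_split_ae b a x y t : dir b a < dir b x -> dir b x < dir b y ->
  P (Some x) (exits_through b a y) = 0 ->
  {ae P (Some x), forall w, reach b y w <= t%:E -> exists r, [/\ (0 <= r <= t)%R,
    reach (~~ b) a w = r%:E & reach b y (theta r%:E w) <= (t - r)%:E]}.
Proof.
move=> ax xy /(ae_notP _ (measurable_exits_through b a y)) no_exit.
have xa : dir (~~ b) x < dir (~~ b) a by rewrite dir_ltN.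
have a_neq_y : a <> y by move=> ay; have := lt_trans ax xy; rewrite ay ltxx.
apply: ae_filterS2 no_exit (reach_after_ae xa xy a_neq_y) => w /negP.
rewrite -leNgt => le_ay after_a yt; have at_ := le_trans le_ay yt.
have [r r0 Da] := ge0_lty_fin (reach_ge0 (~~ b) a w) (le_lt_trans at_ (ltry _)).
have [_ Dy] := after_a _ Da le_ay; exists r; split => //.
  by rewrite r0 -lee_fin -Da.
by rewrite EFinB leeBrDr// -Dy.
Qed.

(* According to whether a is reached before time s. *)
Lemma reach_le_add b a x y s t : dir b a < dir b x -> dir b x < dir b y ->
  P (Some x) (exits_through b a y) = 0 ->
  P (Some x) [set w | reach b y w <= (s + t)%:E] <=
  P (Some a) [set w | reach b y w <= (s + t)%:E] *
    P (Some x) [set w | reach (~~ b) a w <= s%:E] +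
  P (Some a) [set w | reach b y w <= t%:E].
Proof.
move=> ax xy exit0; have xa : dir (~~ b) x < dir (~~ b) a by rewrite dir_ltN.
have mreach := measurable_reach_le; have split_ae := reach_split_ae (s + t) ax xy exit0.
pose reached : set (path_space X) := [set w | reach b y w <= (s + t)%:E].
pose early : set (path_space X) := [set w | reach (~~ b) a w <= s%:E].
have m_early : measurable (reached `&` early) by apply: measurableI; exact: mreach.
have m_late : measurable (reached `&` ~` early).
  by apply: measurableI; [exact: mreach|apply: measurableC; exact: mreach].
rewrite -[X in P _ X <= _]/reached -(setIT reached) -(setUv early) setIUr.
apply: le_trans (measureU2 _ m_early m_late) _; apply: leeD.
  apply: strong_markov_reach_time => //.
  apply: ae_filterS split_ae => w + [yst Da] => /(_ yst)[r [/andP[r0 _] Dr Dy]].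
  by split => //; rewrite Dr; apply: le_trans Dy _; rewrite lee_fin gerBl.
apply: (@le_trans _ _ (P (Some a) [set w | reach b y w <= t%:E] *
    P (Some x) [set w | reach (~~ b) a w <= (s + t)%:E])); last first.
  by rewrite -[leRHS]mule1; apply: lee_wpmul2l => //; apply: pkernel_le1; exact: mreach.
apply: strong_markov_reach_time => //.
apply: ae_filterS split_ae => w + [yst /negP] => /(_ yst)[r [/andP[_ rst] Dr Dy]].
rewrite -ltNge Dr lte_fin => sr; split; first by rewrite /= lee_fin.
by apply: le_trans Dy _; rewrite lee_fin lerBlDr addrC lerD2l ltW.
Qed.

Lemma exits_through_gt0 b a x y : dir b a < dir b x -> dir b x < dir b y ->
  0 < P (Some x) (exits_through b a y).
Proof.
move=> ax xy; rewrite lt_neqAle measure_ge0 andbT eq_sym; apply/eqP => exit0.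
have xa : dir (~~ b) x < dir (~~ b) a by rewrite dir_ltN.
have [k quick_lt1] := reach_le_lt1 xa; set e : R := (k.+1%:R^-1)%R in quick_lt1.
pose pos j := 0 < P (Some x) [set w | reach b y w <= (j%:R * e)%:E].
have [n reach_n] := reach_le_gt0 xy.
have /ex_minnP[[|j] pos_j min_j] : exists j, pos j.
- exists (n * k.+1)%N; apply: (lt_le_trans reach_n); apply: le_measure;
    rewrite ?inE; try exact: measurable_reach_le.
  by move=> w /= Dn; rewrite (le_trans Dn)// lee_fin natrM mulfK.
- move: pos_j; rewrite /pos mul0r lt_neqAle eq_sym => /andP[/eqP + _]; apply.
  apply/(ae_notP _ (measurable_reach_le b y 0)).
  by apply: ae_filterS (reach_gt0_ae xy) => w; rewrite ltNge => /negP.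
have reach_j : P (Some a) [set w | reach b y w <= (j%:R * e)%:E] = 0.
  apply/eqP; rewrite eq_le measure_ge0 andbT.
  apply: le_trans (reach_le_mono _ ax xy) _; rewrite leNgt; apply/negP => /min_j.
  by rewrite ltnn.
have := reach_le_add e (j%:R * e) ax xy exit0.
rewrite reach_j adde0 -[X in (X + _)%R]mul1r -mulrDl nat1r => le_pos.
have mreach := measurable_reach_le.
suff P0 : P (Some x) [set w | reach b y w <= (j.+1%:R * e)%:E] = 0.
  by move: pos_j; rewrite /pos P0 ltxx.
apply: (lee_pmulr_lt1_eq0 _ _ _ quick_lt1) => //; first exact: pkernel_fin_num.
rewrite (le_trans le_pos)// muleC; apply: lee_wpmul2l => //.
exact: reach_le_mono.
Qed.

Definition interval b a y : set Ed :=
  [set q | exists2 e, q = Some e & dir b a < dir b e < dir b y].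

Lemma measurable_interval b a y : measurable (interval b a y : set (borel_cemetery E)).
Proof.
rewrite (_ : interval b a y = ray b (dir b a) `&` ray (~~ b) (dir (~~ b) y)).
  by apply: measurableI; exact: measurable_ray.
apply/seteqP; split=> [_ [e -> /andP[ae ey]]|_ [[e -> ae] [_ [<-]]]].
  by split; exists e => //; rewrite dir_ltN.
by rewrite dir_ltN => ey; exists e; rewrite ?ae.
Qed.

Lemma interval_before_exit b a y w t e : (0 <= t)%R -> X 0 w <> None ->
  X t%:E w = Some e -> t%:E < reach b y w -> t%:E < reach (~~ b) a w ->
  interval b a y (Some e).
Proof.
move=> t0 X0 Xt ty ta; exists e => //; rewrite -(dir_ltN b e a).
by rewrite (entrance_gt_value (regX w) t0 X0 ta Xt)
  (entrance_gt_value (regX w) t0 X0 ty Xt).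
Qed.

Lemma lifetime_ltyP w : lifetime X w < +oo <-> exists n : nat, X n.+1%:R%:E w = None.
Proof.
split=> [/ereal_inf_lt[[t| |] [t0 Xt] //= _]|[n Xn]].
  exists (Num.bound t); rewrite lte_fin in t0; apply: (path_absorbed (regX w) t0 _ Xt).
  by rewrite (le_trans (ltW (unstable.ltr_bound t)))// ler_nat.
by apply: (@le_lt_trans _ _ n.+1%:R%:E); [exact: ereal_inf_lbound|rewrite ltry].
Qed.

Lemma measurable_lifetime_lty :
  measurable ([set w | lifetime X w < +oo] : set (path_space X)).
Proof.
rewrite (_ : mkset _ = [set w | exists n : nat, X n.+1%:R%:E w = None]).
  by apply: (sigma_algebra_exists sP) => n; exact: measurable_coordinate_eq.
by apply/seteqP; split=> w /= /lifetime_ltyP.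
Qed.

Definition leaves b a y : set Omega := [set w | exists p : rat, (0 < (ratr p : R))%R /\
  (X (ratr p)%:E w <> None /\ ~ interval b a y (X (ratr p)%:E w))].

Lemma measurable_leaves b a y : measurable (leaves b a y : set (path_space X)).
Proof.
apply: (sigma_algebra_exists sP) => p; apply: (sigma_algebra_guard_and sP) => p0.
apply: (sigma_algebra_and sP); apply: (sigma_algebra_not sP).
  by apply: measurable_coordinate_eq; exact: ltW.
apply: measurable_coordinate; first by rewrite lee_fin ltW.
exact: measurable_interval.
Qed.

Lemma left_limit_cemetery_leaves b a y w t : (0 < t)%R -> lifetime X w = t%:E ->
  left_limit X t w None -> leaves b a y w.
Proof.
move=> t0 life XN.
have off_segment : \forall s \near t^'-, forall e, X s%:E w = Some e ->
    ~ (dir b a <= dir b e <= dir b y) by exact: XN _ (near_cemetery_dir nE b a y).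
have [p /andP[p0 pt] off_p] := at_left_rat t0 off_segment.
exists p; split => //; split.
  move=> Xp; have : lifetime X w <= (ratr p)%:E by apply: ereal_inf_lbound.
  by rewrite life lee_fin leNgt pt.
by move=> [e Xp /andP[/ltW ae /ltW ey]]; apply: (off_p e Xp); rewrite ae.
Qed.

Lemma leaves_before_death_ae b a x y :
  {ae P (Some x), forall w, lifetime X w < +oo -> leaves b a y w}.
Proof.
have [life0|life_neq0] := eqVneq (P (Some x) [set w | lifetime X w < +oo]) 0.
  have /(ae_notP _ measurable_lifetime_lty) := life0.
  by apply: ae_filterS => w.
have [_ _ _ /(_ x)] := sfhX.
rewrite [X in 0 < X](completed_measureE (P (Some x)) measurable_lifetime_lty).
rewrite lt_neqAle measure_ge0 eq_sym life_neq0 => /(_ isT)[_].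
rewrite [RHS](completed_measureE (P (Some x)) measurable_lifetime_lty).
apply: ae_sub_full_outer.
- exact: measurable_lifetime_lty.
- exact: measurable_leaves.
- rewrite -ge0_fin_numE//; apply: pkernel_fin_num; exact: measurable_lifetime_lty.
- by move=> w [t [_ life _]]; rewrite /= life ltry.
- by move=> w [t [t0 life XN]]; exact: left_limit_cemetery_leaves XN.
Qed.

Lemma alive_before_exit_ae b a x y : dir b a < dir b x -> dir b x < dir b y ->
  {ae P (Some x), forall w, forall t, (0 <= t)%R ->
    t%:E < reach b y w -> t%:E < reach (~~ b) a w -> X t%:E w <> None}.
Proof.
move=> ax xy.
apply: ae_filterS2 (initial_value_ae HX (Some x)) (leaves_before_death_ae b a x y).
move=> w Xx leaves_w t t0 ty ta Xt.
have X0 : X 0 w <> None by rewrite Xx.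
have tpos : (0 < t)%R.
  by rewrite lt_neqAle t0 andbT; apply/eqP => t00; apply: X0; rewrite -Xt -t00.
have [|p [p0 [Xp]]] := leaves_w.
  by apply: (@le_lt_trans _ _ t%:E); [exact: ereal_inf_lbound|rewrite ltry].
have pt : (ratr p < t)%R.
  by rewrite ltNge; apply/negP => tp; apply: Xp; exact: (path_absorbed (regX w) tpos tp Xt).
case Xe : (X (ratr p)%:E w) Xp => [e|//] _; apply.
apply: interval_before_exit Xe _ _ => //; first exact: ltW.
  by rewrite (lt_trans _ ty)// lte_fin.
by rewrite (lt_trans _ ta)// lte_fin.
Qed.

Definition never_exits b a y : set Omega :=
  [set w | reach b y w = +oo /\ reach (~~ b) a w = +oo].

Lemma measurable_never_exits b a y : measurable (never_exits b a y : set (path_space X)).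
Proof.
have m_fin b' z : measurable ([set w | reach b' z w < +oo] : set (path_space X)).
  rewrite (_ : mkset _ = [set w | exists n : nat, reach b' z w <= n%:R%:E]).
    by apply: (sigma_algebra_exists sP) => n; exact: measurable_reach_le.
  by apply/seteqP; split=> w /= /(lty_natP (reach_ge0 b' z w)).
rewrite (_ : never_exits b a y =
    [set w | ~ (reach b y w < +oo) /\ ~ (reach (~~ b) a w < +oo)]).
  by apply: (sigma_algebra_and sP); apply: (sigma_algebra_not sP); exact: m_fin.
have eqyP (v : \bar R) : v = +oo <-> ~ (v < +oo).
  by rewrite ltey; split=> [->|/negP/negPn/eqP//]; rewrite eqxx.
by apply/seteqP; split=> w [/eqyP Dy /eqyP Da].
Qed.

Lemma never_exits_le b a x y (n : nat) (c : \bar R) :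
  dir b a < dir b x -> dir b x < dir b y -> 0 <= c ->
  (forall z, dir b a < dir b z -> dir b z < dir b y ->
    P (Some z) (never_exits b a y) <= c) ->
  P (Some x) (never_exits b a y) <= c * (1 - P (Some x) [set w | reach b y w <= n%:R%:E]).
Proof.
move=> ax xy c0 le_c; have mreach := measurable_reach_le.
have mnever := measurable_never_exits b a y; have n0 : (0 <= n%:R :> R)%R by exact: ler0n.
pose A : set (path_space X) := ~` [set w | reach b y w <= n%:R%:E] `&`
  ~` [set w | reach (~~ b) a w <= n%:R%:E].
have mA : measurable A by apply: measurableI; apply: measurableC; exact: mreach.
have FA : stopped_filtration P (fun=> n%:R%:E) A.
  have sF := filtration_sigma_algebra P n%:R%:E.
  apply: stopped_filtration_cst; apply: (sigma_algebra_and sF);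
    apply: (sigma_algebra_not sF); apply: stopping_time_le => //;
    exact: reach_stopping_time.
have alive := ae_filterI (initial_value_ae HX (Some x)) (alive_before_exit_ae ax xy).
apply: (@le_trans _ _ (c * P (Some x) A)); last first.
  apply: lee_wpmul2l => //; rewrite -pkernel_setC//.
  by apply: le_measure; rewrite ?inE//; [exact: measurableC|exact: subIsetl].
apply: (strong_markov_le HX (cst_stopping_time P (n0 : 0 <= n%:R%:E)) FA mA mnever) => //.
  apply: ae_filterS alive => w [Xx alive_w] [/negP + /negP]; rewrite -!ltNge => ny na.
  have X0 : X 0 w <> None by rewrite Xx.
  case Xn : (X n%:R%:E w) (alive_w _ n0 ny na) => [e|//] _.
  by have [_ [<-] /andP[ae ey]] := interval_before_exit n0 X0 Xn ny na; exact: le_c.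
apply: ae_filterS alive => w [Xx alive_w] [Dy Da].
have X0 : X 0 w <> None by rewrite Xx.
have ny : n%:R%:E < reach b y w by rewrite Dy ltry.
have na : n%:R%:E < reach (~~ b) a w by rewrite Da ltry.
have Xn := alive_w _ n0 ny na; split; first by split; apply/negP; rewrite -ltNge.
have := entry_theta HX n0 X0 Xn ny; have := entry_theta HX n0 X0 Xn na.
rewrite -!/(reach _ _ _) /never_exits/= Dy Da.
by case: (reach (~~ b) a _) => [?| |]//; case: (reach b y _).
Qed.

Lemma exits_ae b a x y : dir b a < dir b x -> dir b x < dir b y ->
  {ae P (Some x), forall w, ~ never_exits b a y w}.
Proof.
move=> ax xy; have mnever := measurable_never_exits b a y.
pose between : set E := [set z | dir b a < dir b z /\ dir b z < dir b y].
pose m := ereal_sup [set P (Some z) (never_exits b a y) | z in between].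
have m_ge z : between z -> P (Some z) (never_exits b a y) <= m.
  by move=> bz; apply: ereal_sup_ubound; exists z.
have m0 : 0 <= m by apply: le_trans (m_ge x _).
have m1 : m <= 1 by apply: ge_ereal_sup => _ [z _ <-]; exact: pkernel_le1.
have [n reach_n] := reach_le_gt0 (lt_trans ax xy).
pose delta := P (Some a) [set w | reach b y w <= n%:R%:E].
have delta_fin : delta \is a fin_num by apply: pkernel_fin_num; exact: measurable_reach_le.
apply/(ae_notP _ mnever)/eqP; rewrite eq_le measure_ge0 andbT.
apply: (le_trans (m_ge x _)) => //.
rewrite (lee_pmulr_lt1_eq0 (r := 1 - delta) m0)//.
- by rewrite ge0_fin_numE// (le_lt_trans m1)// ltry.
- by rewrite sube_ge0 ?delta_fin//; apply: pkernel_le1; exact: measurable_reach_le.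
- by rewrite lteBlDr// lteDl// -EFinD.
rewrite muleC; apply: ge_ereal_sup => _ [z [az zy] <-].
apply: le_trans (never_exits_le n az zy m0 _) _; first by move=> v av vy; exact: m_ge.
by apply: lee_wpmul2l => //; apply: leeB => //; exact: reach_le_mono.
Qed.

Lemma reach_neq_ae b a x y : dir b a < dir b x -> dir b x < dir b y ->
  {ae P (Some x), forall w, reach b y w <> reach (~~ b) a w}.
Proof.
move=> ax xy; have xa : dir (~~ b) x < dir (~~ b) a by rewrite dir_ltN.
have y_neq_a : y <> a by move=> ya; have := lt_trans ax xy; rewrite ya ltxx.
apply: ae_filterS2 (exits_ae ax xy) (reach_after_ae xy xa y_neq_a) => w exit_w after_y Dya.
have [yoo|] := eqVneq (reach b y w) +oo.
  by apply: exit_w; rewrite /never_exits/= -Dya.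
rewrite -ltey => /(ge0_lty_fin (reach_ge0 b y w))[t _ Dy].
have [|+ _] := after_y t Dy; first by rewrite Dya.
by rewrite -Dya Dy ltxx.
Qed.

Lemma exits_through_compl b a x y : dir b a < dir b x -> dir b x < dir b y ->
  P (Some x) (exits_through (~~ b) y a) = 1 - P (Some x) (exits_through b a y).
Proof.
move=> ax xy; have mexit := measurable_exits_through; rewrite -pkernel_setC//.
apply: measure_ae_eq; [exact: mexit|by apply: measurableC; exact: mexit|].
apply: ae_filterS (reach_neq_ae ax xy) => w neq.
rewrite /exits_through/= negbK; split=> [lt|/negP]; first by apply/negP; rewrite -leNgt ltW.
by rewrite -leNgt le_eqVlt => /orP[/eqP ya|//]; case: neq.
Qed.

Lemma exits_below_cvg b a x y : dir b a < dir b x -> dir b x < dir b y ->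
  P (Some x) [set w | entry X b (below (dir b y) n) w < reach (~~ b) a w] @[n --> \oo] -->
  P (Some x) (exits_through b a y).
Proof.
move=> ax xy; pose F n : set (path_space X) :=
  [set w | entry X b (below (dir b y) n) w < reach (~~ b) a w].
have mF n : measurable (F n) by exact: measurable_entry_lt.
have mcapF : measurable (\bigcap_n F n) by exact: bigcapT_measurable.
have <- : P (Some x) (\bigcap_n F n) = P (Some x) (exits_through b a y).
  apply: measure_ae_eq => //; first exact: measurable_exits_through.
  apply: ae_filterS (reach_neq_ae ax xy) => w neq; split=> [below_lt_a|exit_w n _].
    rewrite /exits_through/= lt_neqAle; apply/andP; split; first exact/eqP.
    have reach_cvg := entrance_cvg (b := b) (c := dir b y) (regX w).
    apply: (cvge_to_le reach_cvg); apply: nearW => n.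
    exact: ltW (below_lt_a n I).
  by apply: le_lt_trans exit_w; exact/entrance_nd/below_le.
apply: nonincreasing_cvg_mu => //.
  by rewrite -ge0_fin_numE//; exact: (pkernel_fin_num P _ (mF _)).
move=> m n mn; apply/subsetPset => w /=; apply: le_lt_trans.
exact/entrance_nd/below_nd.
Qed.

Lemma exits_through_near b a x y (c : \bar R) : dir b a < dir b x -> dir b x < dir b y ->
  P (Some x) (exits_through b a y) < c ->
  \forall z \near y, P (Some x) (exits_through b a z) < c.
Proof.
move=> ax xy /open_ereal_lt'/(exits_below_cvg ax xy) lt_c.
have [n lt_cn] := filter_ex (lt_c : \forall n \near \oo, _).
apply: filterS (near_dir_gt (below_lt n (le_lt_trans (leNye _) xy))) => z nz.
apply: le_lt_trans lt_cn; apply: le_measure; rewrite ?inE.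
- exact: measurable_exits_through.
- exact: measurable_entry_lt.
- by move=> w; apply: le_lt_trans; exact/entrance_nd/ltW.
Qed.

Lemma hitting_exits_through x a y : set_val a < set_val x -> set_val x < set_val y ->
  @completed_measure_extension _ _ _ (P (Some x))
    [set w | hitting X (Some y) w < hitting X (Some a) w] =
  P (Some x) (exits_through false a y).
Proof.
move=> ax xy; have xa : dir true x < dir true a by rewrite (dir_ltN false).
rewrite -(completed_measureE (P (Some x)) (measurable_exits_through false a y)).
apply: completed_ae_eq.
apply: ae_filterS2 (hitting_entry_ae HX sfX nE (b := false) xy)
  (hitting_entry_ae HX sfX nE xa).
by move=> w Hy Ha /=; rewrite Hy Ha.
Qed.

Definition exit_prob a x y : R := fine (P (Some x) (exits_through false a y)).

Lemma exit_probE a x y : P (Some x) (exits_through false a y) = (exit_prob a x y)%:E.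
Proof. by rewrite fineK// pkernel_fin_num//; exact: measurable_exits_through. Qed.

Lemma exit_prob_gt0 a x y : set_val a < set_val x -> set_val x < set_val y ->
  (0 < exit_prob a x y)%R.
Proof. by move=> ax xy; rewrite -lte_fin -exit_probE; exact: exits_through_gt0. Qed.

Lemma exit_prob_compl a x y : set_val a < set_val x -> set_val x < set_val y ->
  P (Some x) (exits_through true y a) = (1 - exit_prob a x y)%:E.
Proof.
by move=> ax xy; rewrite (exits_through_compl (b := false) ax xy) exit_probE EFinB.
Qed.

Lemma exit_prob_lt1 a x y : set_val a < set_val x -> set_val x < set_val y ->
  (exit_prob a x y < 1)%R.
Proof.
move=> ax xy; rewrite -subr_gt0 -lte_fin -exit_prob_compl//.
by apply: exits_through_gt0; rewrite (dir_ltN false).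
Qed.

Lemma exit_prob_mul a x y z :
  set_val a < set_val x -> set_val x < set_val y -> set_val y < set_val z ->
  exit_prob a x z = (exit_prob a x y * exit_prob a y z)%R.
Proof.
move=> ax xy yz; apply: EFin_inj; rewrite EFinM -!exit_probE.
exact: (exits_through_mul (b := false)).
Qed.

Lemma exit_prob_compl_mul a x y z :
  set_val a < set_val x -> set_val x < set_val y -> set_val y < set_val z ->
  (1 - exit_prob a y z = (1 - exit_prob x y z) * (1 - exit_prob a x z))%R.
Proof.
move=> ax xy yz; apply: EFin_inj; rewrite EFinM.
rewrite -!exit_prob_compl ?(lt_trans ax xy) ?(lt_trans xy yz)//.
by apply: exits_through_mul; rewrite (dir_ltN false).
Qed.

End skip_free_hunt_processes.

(** * The scale function *)

Section harmonic_functions.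
Context {R : realType} {E : set (\bar R)}.
Implicit Types (a c d x y z : E) (S : set E) (h g : E -> R).
Variable p : E -> E -> E -> R.
Local Notation "x <E y" := (set_val x < set_val y) (at level 70).
Local Notation "x <=E y" := (set_val x <= set_val y) (at level 70).

Definition harmonic_on S h : Prop :=
  (forall x y, S x -> S y -> x <E y -> (h x < h y)%R) /\
  (forall a x y, S a -> S x -> S y -> a <E x -> x <E y ->
    (p a x y * (h y - h a) = h x - h a)%R).

Lemma harmonic_onS S S' h : S' `<=` S -> harmonic_on S h -> harmonic_on S' h.
Proof.
move=> S'S [hlt hp]; split=> [x y /S'S Sx /S'S Sy|a x y /S'S Sa /S'S Sx /S'S Sy].
  exact: hlt.
exact: hp.
Qed.

Lemma harmonic_on_affine S h g (k c : R) : (0 < k)%R ->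
  (forall z, S z -> h z = (k * g z + c)%R) -> harmonic_on S h -> harmonic_on S g.
Proof.
move=> k0 hE [hlt hp]; split=> [x y Sx Sy xy|a x y Sa Sx Sy ax xy].
  by have := hlt x y Sx Sy xy; rewrite !hE// ltrD2r ltr_pM2l.
apply: (mulfI (lt0r_neq0 k0)); have := hp a x y Sa Sx Sy ax xy.
rewrite !hE//; have cancel (m n : R) : (m + c - (n + c) = m - n)%R by ring.
by rewrite !cancel -!mulrBr mulrCA.
Qed.

Lemma harmonic_on_setT h :
  (forall a y, a <E y -> harmonic_on [set z | a <=E z /\ z <=E y] h) ->
  harmonic_on setT h.
Proof.
move=> hseg; split=> [x y _ _ xy|a x y _ _ _ ax xy].
  by have [+ _] := hseg x y xy; apply => //=; rewrite lexx (ltW xy).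
have ay := lt_trans ax xy.
by have [_ +] := hseg a y ay; apply => //=; rewrite ?lexx ?(ltW ax) ?(ltW xy) ?(ltW ay).
Qed.

Hypothesis p_gt0 : forall a x y, a <E x -> x <E y -> (0 < p a x y)%R.
Hypothesis p_lt1 : forall a x y, a <E x -> x <E y -> (p a x y < 1)%R.

(* The value at z of a harmonic function equal to 0 at c and to 1 at d, solved
   from the single relation between c, d and z. *)
Definition normalized_scale c d z : R :=
  (if z <E c then - p z c d / (1 - p z c d)
   else if set_val z == set_val c then 0
   else if z <E d then p c z d
   else if set_val z == set_val d then 1
   else (p c d z)^-1)%R.

Lemma harmonic_normalized S h c d z : harmonic_on S h -> c <E d ->
  S c -> S d -> S z -> (h z = (h d - h c) * normalized_scale c d z + h c)%R.
Proof.
move=> [hlt hp] cd Sc Sd Sz; have hcd := hlt _ _ Sc Sd cd.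
rewrite /normalized_scale; case: (ltgtP (set_val z) (set_val c)) => [zc|cz|/val_inj ->].
- have := hp _ _ _ Sz Sc Sd zc cd; have := p_lt1 zc cd.
  set q := p z c d => q1 qE; have q1' : (1 - q != 0)%R by rewrite subr_eq0 gt_eqF.
  apply: (mulfI q1').
  have -> : ((1 - q) * ((h d - h c) * (- q / (1 - q)) + h c) =
     - (h d - h c) * q + (1 - q) * h c)%R by field.
  lra.
- case: (ltgtP (set_val z) (set_val d)) => [zd|dz|/val_inj ->].
  + by have := hp _ _ _ Sc Sz Sd cz zd; lra.
  + have := hp _ _ _ Sc Sd Sz cd dz; have := p_gt0 cd dz.
    set q := p c d z => q0 qE; have q0' : (q != 0)%R by rewrite gt_eqF.
    apply: (mulfI q0').
    have -> : (q * ((h d - h c) * q^-1 + h c) = (h d - h c) + q * h c)%R by field.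
    lra.
  + lra.
- lra.
Qed.

Hypothesis p_mul : forall a x y z, a <E x -> x <E y -> y <E z ->
  p a x z = (p a x y * p a y z)%R.
Hypothesis p_compl_mul : forall a x y z, a <E x -> x <E y -> y <E z ->
  (1 - p a y z = (1 - p x y z) * (1 - p a x z))%R.

Definition exit_profile A B z : R :=
  if z <=E A then 0%R else if z <E B then p A z B else 1%R.

Lemma exit_profile_left A B : exit_profile A B A = 0%R.
Proof. by rewrite /exit_profile lexx. Qed.

Lemma exit_profile_gt0 A B x : A <E x -> (0 < exit_profile A B x)%R.
Proof.
by move=> Ax; rewrite /exit_profile leNgt Ax/=; case: ifPn => // xB; exact: p_gt0.
Qed.

Lemma exit_profile_mul A B x y : A <E x -> x <E y -> y <=E B ->
  (exit_profile A B x = p A x y * exit_profile A B y)%R.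
Proof.
move=> Ax xy yB; have xB := lt_le_trans xy yB; have Ay := lt_trans Ax xy.
rewrite /exit_profile !leNgt Ax Ay xB/=; case: ifPn => [yB'|]; first exact: p_mul.
rewrite -leNgt => By; have -> : y = B by apply: val_inj; apply/eqP; rewrite eq_le yB.
by rewrite mulr1.
Qed.

Lemma harmonic_exit_profile A B :
  harmonic_on [set z | A <=E z /\ z <=E B] (exit_profile A B).
Proof.
split=> [x y [Ax xB] [Ay yB] xy|a x y [Aa aB] [Ax xB] [Ay yB] ax xy].
  move: Ax; rewrite le_eqVlt => /orP[/eqP/val_inj Ax|Ax].
    by rewrite -Ax in xy *; rewrite exit_profile_left; exact: exit_profile_gt0.
  rewrite (exit_profile_mul Ax xy yB) gtr_pMl; first exact: p_lt1.
  exact/exit_profile_gt0/(lt_trans Ax).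
have Ax' : A <E x by exact: le_lt_trans Aa ax.
move: Aa; rewrite le_eqVlt => /orP[/eqP/val_inj Aa|Aa].
  by rewrite -Aa in ax *; rewrite exit_profile_left !subr0 -exit_profile_mul.
have ay := lt_trans ax xy.
rewrite (exit_profile_mul Aa ay yB) (exit_profile_mul Ax' xy yB).
have := p_compl_mul Aa ax xy; nra.
Qed.

Lemma harmonic_normalized_scale c d : c <E d -> harmonic_on setT (normalized_scale c d).
Proof.
move=> cd; apply: harmonic_on_setT => a y ay.
have [A [Aa Ac]] : exists A : E, A <=E a /\ A <=E c.
  by have [ac|/ltW ca] := leP (set_val a) (set_val c); [exists a|exists c].
have [B [yB dB]] : exists B : E, y <=E B /\ d <=E B.
  by have [yd|/ltW dy] := leP (set_val y) (set_val d); [exists d|exists y].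
have hAB := harmonic_exit_profile A B; pose S : set E := [set z | A <=E z /\ z <=E B].
have Sc : S c by split => //; exact: le_trans (ltW cd) dB.
have Sd : S d by split => //; exact: le_trans Ac (ltW cd).
apply: (@harmonic_onS S) => [z [az zy]|].
  by split; [exact: le_trans az|exact: le_trans yB].
apply: (harmonic_on_affine _ (fun z Sz => harmonic_normalized hAB cd Sc Sd Sz) hAB).
by rewrite subr_gt0; exact: hAB.1.
Qed.

End harmonic_functions.

Section scale_functions.
Context {R : realType} {E : set (\bar R)} {Omega : pointedType}.
Variables (X : \bar R -> Omega -> cemetery E) (theta : \bar R -> Omega -> Omega).
Variable P : R.-pker (borel_cemetery E) ~> (path_space X).
Hypotheses (nE : nearly_closed E) (sfhX : skip_free_hunt theta P).
Implicit Types (a x y z : E) (b : bool).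

Section continuity.
Variable s : E -> R.
Hypothesis hs : harmonic_on (exit_prob P) setT s.

Let sdir b z : R := if b then (- s z)%R else s z.

Let sdir_lt b x y : dir b x < dir b y -> (sdir b x < sdir b y)%R.
Proof. by case: b; rewrite /dir /sdir ?lteN2 ?ltrN2 => xy; exact: hs.1. Qed.

Let exits_through_sdir b a x y : dir b a < dir b x -> dir b x < dir b y ->
  P (Some x) (exits_through X b a y) =
  ((sdir b x - sdir b a) / (sdir b y - sdir b a))%:E.
Proof.
move=> ax xy; have ay := lt_trans ax xy.
have : (sdir b y - sdir b a != 0)%R by rewrite subr_eq0 gt_eqF// sdir_lt.
case: b ax xy ay => /=; rewrite /dir /sdir ?lteN2 => ax xy ay ne.
  rewrite (exit_prob_compl nE sfhX)//; congr EFin.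
  have := hs.2 y x a I I I xy ax => e; apply: (mulIf ne); rewrite mulfVK//; lra.
rewrite (exit_probE sfhX); congr EFin.
by apply: (mulIf ne); rewrite mulfVK//; exact: hs.2.
Qed.

Let isolated_from_below b y : ~ (exists x a, dir b a < dir b x /\ dir b x < dir b y) ->
  \forall z \near y, dir b z <= dir b y -> z = y.
Proof.
move=> none_between; have [[x xy]|minimal] := pselect (exists x, dir b x < dir b y).
  apply: filterS (near_dir_gt xy) => z xz.
  rewrite le_eqVlt => /orP[/eqP/dir_inj//|zy].
  by exfalso; apply: none_between; exists z, x.
apply: (@filterE _ (nbhs y)) => z; rewrite le_eqVlt => /orP[/eqP/dir_inj//|zy].
by exfalso; apply: minimal; exists z.
Qed.

Let sdir_near_below b y (e : R) : (0 < e)%R ->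
  \forall z \near y, dir b z <= dir b y -> (sdir b y - sdir b z < e)%R.
Proof.
move=> e0; have [[x [a [ax xy]]]|] :=
  pselect (exists x a, dir b a < dir b x /\ dir b x < dir b y); last first.
  by move=> /isolated_from_below; apply: filterS => z zy /zy ->; rewrite subrr.
have sax := sdir_lt ax; have say := lt_trans sax (sdir_lt xy).
have [large_e|small_e] := leP (sdir b y - sdir b a)%R e.
  by apply: filterS (near_dir_gt xy) => z /sdir_lt sxz _; lra.
have lt_prob : P (Some x) (exits_through X b a y) <
    ((sdir b x - sdir b a) / (sdir b y - sdir b a - e))%:E.
  rewrite exits_through_sdir// lte_fin ltr_pM2l ?subr_gt0// ltf_pV2 ?posrE ?subr_gt0//.
  by rewrite gtrBl.
apply: filterS2 (exits_through_near nE sfhX ax xy lt_prob) (near_dir_gt xy) => z + xz _.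
have saz := lt_trans sax (sdir_lt xz).
rewrite exits_through_sdir// lte_fin ltr_pM2l ?subr_gt0// ltf_pV2 ?posrE ?subr_gt0//.
lra.
Qed.

Lemma harmonic_continuous : continuous s.
Proof.
move=> y; apply/(@cvgrPdist_lt _ _ _ (nbhs y)) => e e0.
apply: filterS2 (sdir_near_below false y e0) (sdir_near_below true y e0) => z up down.
have [zy|yz] := leP (set_val z) (set_val y).
  have := up zy; rewrite /sdir; move: zy; rewrite le_eqVlt => /orP[/eqP/val_inj ->|zy].
    by rewrite subrr normr0.
  by rewrite gtr0_norm// subr_gt0; exact: hs.1.
have := down; rewrite /dir leeN2 => /(_ (ltW yz)); rewrite /sdir.
by rewrite ltr0_norm ?subr_lt0; [lra|exact: hs.1].
Qed.

End continuity.

Lemma scale_functionP (s : E -> R) :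
  scale_function P s <-> continuous s /\ harmonic_on (exit_prob P) setT s.
Proof.
have quotient a x y : (s a < s y)%R ->
    (exit_prob P a x y * (s y - s a) = s x - s a)%R <->
    exit_prob P a x y = ((s x - s a) / (s y - s a))%R.
  move=> ay; have ne : (s y - s a != 0)%R by rewrite subr_eq0 gt_eqF.
  by split=> [<-|->]; [rewrite mulfK|rewrite mulfVK].
split=> [[cs ss ps]|[cs [ss ps]]].
  split => //; split=> [x y _ _|a x y _ _ _ ax xy]; first exact: ss.
  apply/quotient; first exact/ss/(lt_trans ax).
  have := ps a x y; rewrite ax xy => /(_ isT).
  by rewrite (hitting_exits_through nE sfhX)// (exit_probE sfhX) => -[].
split => //; first by move=> x y; exact: ss.
move=> a x y /andP[ax xy]; have ay := lt_trans ax xy.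
rewrite (hitting_exits_through nE sfhX)// (exit_probE sfhX); congr EFin.
by apply/quotient; [exact: ss|exact: ps].
Qed.

Lemma scale_function_subsingleton (s : E -> R) :
  (forall x y : E, x = y) -> scale_function P s.
Proof.
move=> eqE; split=> [x|x y|a x y /andP[+ _]].
- rewrite (_ : s = fun=> s x); first exact: cst_continuous.
  by apply/funext => y; rewrite (eqE y x).
- by rewrite (eqE x y) ltxx.
- by rewrite (eqE a x) ltxx.
Qed.

Lemma scale_function_normalized c d : set_val c < set_val d ->
  scale_function P (normalized_scale (exit_prob P) c d).
Proof.
move=> cd; have harm := harmonic_normalized_scale (exit_prob_gt0 nE sfhX)
  (exit_prob_lt1 nE sfhX) (exit_prob_mul nE sfhX) (exit_prob_compl_mul nE sfhX) cd.
by apply/scale_functionP; split => //; exact: harmonic_continuous.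
Qed.

Lemma scale_function_affine c d (s : E -> R) : set_val c < set_val d ->
  scale_function P s -> (0 < s d - s c)%R /\
  forall x, (s x = (s d - s c) * normalized_scale (exit_prob P) c d x + s c)%R.
Proof.
move=> cd /scale_functionP[_ harm]; split; first by rewrite subr_gt0; exact: harm.1.
move=> x; have p_gt0 := exit_prob_gt0 nE sfhX; have p_lt1 := exit_prob_lt1 nE sfhX.
exact: (harmonic_normalized p_gt0 p_lt1 harm cd).
Qed.

End scale_functions.

Local Close Scope ereal_scope.

Theorem theorem2p5 (R : realType) (E : set (\bar R)) (Omega : pointedType)
    (X : \bar R -> Omega -> cemetery E) (theta : \bar R -> Omega -> Omega)
    (P : R.-pker (borel_cemetery E) ~> (path_space X)) :
  nearly_closed E ->
  skip_free_hunt theta P ->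
  exists s : E -> R,
    scale_function P s /\
    forall s' : E -> R, scale_function P s' ->
      exists alpha beta : R,
        0 < alpha /\ forall x : E, s' x = alpha * s x + beta.
Proof.
move=> nE sfhX.
have [[c [d cd]]|no_pair] := pselect (exists c d : E, (set_val c < set_val d)%E).
  exists (normalized_scale (exit_prob P) c d).
  split; first exact: (scale_function_normalized nE sfhX cd).
  move=> s' /(scale_function_affine nE sfhX cd)[alpha_gt0 s'E].
  by exists (s' d - s' c), (s' c).
have eqE (x y : E) : x = y.
  apply: val_inj; apply/eqP; rewrite eq_le !leNgt; apply/andP.
  by split; apply/negP => lt; apply: no_pair; [exists y, x|exists x, y].
exists (fun=> 0); split; first exact: scale_function_subsingleton.
move=> s' _; have [[x0 _]|noE] := pselect (exists x : E, True).
  by exists 1, (s' x0); split => // x; rewrite mulr0 add0r (eqE x x0).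
by exists 1, 0; split => // x; case: noE; exists x.
Qed.
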